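(* Let $\Theta:\mathcal C\to\mathcal C$ be continuous and affine. Assume that $\Theta$ satisfies the following properties. (S1) $\Theta(C^\gamma)=\Theta(C)^\gamma$ for every $C\in\mathcal C$ and $\gamma\in\mathcal D_4$. (S2) $\Theta(\Pi)=\Pi$ and $\Theta(M)=M$. (S3) $Q(\Theta(C),D)=Q(C,\Theta(D))$ for every $C,D\in\mathcal C$. Then $\nu^\Theta=(\nu^\Theta_C)_{C\in\mathcal C}$ with $\nu_C^\Theta=4\mu_{\Theta(C)}$ (restricted to $(0,1)^2$) is an admissible field. The corresponding measure of concordance, i.e. $$\kappa_\Theta(C)=\int_{(0,1)^2}(C-\Pi)\,\mathrm d\nu^\Theta_\Pi+\int_{(0,1)^2}(C-\Pi)\,\mathrm d\nu^\Theta_C,\qquad C\in\mathcal C,$$ and its canonical polarization are given by $\kappa_\Theta(C)=Q(\Theta(C),C)$ and $b_{\kappa_\Theta}(C,D)=Q(\Theta(C),D)$ for all $C,D\in\mathcal C$, respectively. Moreover, $\kappa_\Theta$ is a measure of concordance of exact degree two.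
   Context: $\mathcal C$ is the set of all bivariate copulas, with the uniform topology; $\mu_C$ is the Borel probability measure on $[0,1]^2$ associated with $C\in\mathcal C$. $M(u,v)=\min(u,v)$, $W(u,v)=\max(u+v-1,0)$, $\Pi(u,v)=uv$. $C\preceq D$ means $C(u,v)\le D(u,v)$ for all $(u,v)\in[0,1]^2$. For $C,D\in\mathcal C$, $Q(C,D)=4\int_{[0,1]^2}C\,\mathrm d\mu_D-1$. $\mathcal D_4$ is the (8-element) symmetry group of $[0,1]^2$ generated by $\pi(u,v)=(v,u)$ and $\sigma_1(u,v)=(1-u,v)$ under composition. For $\gamma\in\mathcal D_4$ and $C\in\mathcal C$, $C^\gamma$ is the copula with $\mu_{C^\gamma}=\gamma_\#\mu_C$, where $\gamma_\#\mu(A)=\mu(\gamma^{-1}(A))$. A functional $\kappa:\mathcal C\to\mathbb R$ is a measure of concordance if: (A1) $\kappa(C^\pi)=\kappa(C)$ for every $C$; (A2) $C\preceq D$ implies $\kappa(C)\le\kappa(D)$; (A3) $\kappa(M)=1$; (A4) $\kappa(C^{\sigma_1})=-\kappa(C)$ for every $C$; (A5) $C_n\to C$ uniformly implies $\kappa(C_n)\to\kappa(C)$. $\kappa:\mathcal C\to\mathbb R$ has degree at most two if for every $C,D\in\mathcal C$ the map $t\mapsto\kappa((1-t)C+tD)$ agrees on $[0,1]$ with a real polynomial of degree at most two; it has exact degree two if it has degree at most two but is not affine on $\mathcal C$. The canonical polarization of $\kappa$ is $b_\kappa(C,D)=2\kappa\left(\frac{C+D}{2}\right)-\frac{\kappa(C)+\kappa(D)}{2}$,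 $C,D\in\mathcal C$. Let $w=M-W$, i.e. $w(u,v)=\min\{u,v,1-u,1-v\}$. $\mathfrak M_w^+$ is the set of non-negative Borel measures $\nu$ on $(0,1)^2$ with $\int_{(0,1)^2}w\,\mathrm d\nu<\infty$. Since $|C-\Pi|\le w$ for every copula $C$, integrals of $C-\Pi$ against such measures are finite; integrals against a difference of two such measures mean the difference of the integrals. A field $\nu=(\nu_C)_{C\in\mathcal C}$ of measures is admissible if: (P1) $\nu_C\in\mathfrak M_w^+$ for every $C\in\mathcal C$; (P2) $\nu_{(1-t)C+tD}=(1-t)\nu_C+t\nu_D$ for all $C,D\in\mathcal C$, $0\le t\le1$; (P3) $\int_{(0,1)^2}(D-\Pi)\,\mathrm d(\nu_C-\nu_\Pi)=\int_{(0,1)^2}(C-\Pi)\,\mathrm d(\nu_D-\nu_\Pi)$ for all $C,D\in\mathcal C$; (P4) $\nu_{C^\gamma}=\gamma_\#\nu_C$ for all $C\in\mathcal C$, $\gamma\in\mathcal D_4$; (P5) the map $C\mapsto\int_{(0,1)^2}(C-\Pi)\,\mathrm d\nu_\Pi+\int_{(0,1)^2}(C-\Pi)\,\mathrm d\nu_C$ is continuous on $\mathcal C$; (P6) $\int_{(0,1)^2}(M-\Pi)\,\mathrm d\nu_\Pi+\int_{(0,1)^2}(M-\Pi)\,\mathrm d\nu_M=1$. *)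

(* Defs.v *)
From HB Require Import structures.
From mathcomp Require Import all_boot all_order all_algebra.
From mathcomp Require Import interval_inference.
From mathcomp Require Import all_classical all_reals all_analysis.
From mathcomp Require Import lra.

Set Implicit Arguments.
Unset Strict Implicit.
Unset Printing Implicit Defensive.

Import Order.TTheory GRing.Theory Num.Theory.
Import numFieldNormedType.Exports.

Local Open Scope classical_set_scope.
Local Open Scope ring_scope.

Section copulas.
Context {R : realType}.

Definition unit_square : set (R * R) := `[0, 1] `*` `[0, 1].

Definition open_square : set (R * R) := `]0, 1[ `*` `]0, 1[.

(* Extension by zero outside the unit square (the first clause) makes Leibniz
   equality of copulas the same as equality on the unit square. *)
Record is_copula (C : R * R -> R) : Prop := IsCopula {
  copula_out : forall p, ~ unit_square p -> C p = 0 ;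
  copula_groundl : forall v : R, 0 <= v <= 1 -> C (0, v) = 0 ;
  copula_groundr : forall u : R, 0 <= u <= 1 -> C (u, 0) = 0 ;
  copula_marginl : forall u : R, 0 <= u <= 1 -> C (u, 1) = u ;
  copula_marginr : forall v : R, 0 <= v <= 1 -> C (1, v) = v ;
  copula_2incr : forall u1 u2 v1 v2 : R,
    0 <= u1 -> u1 <= u2 -> u2 <= 1 -> 0 <= v1 -> v1 <= v2 -> v2 <= 1 ->
    0 <= C (u2, v2) - C (u2, v1) - C (u1, v2) + C (u1, v1)
}.

Definition copulas : set {uniform` unit_square -> R} :=
  [set C : R * R -> R | is_copula C].

End copulas.

(* The topology is that of uniform convergence on the unit square, induced on
   the subtype. *)
Definition copula (R : realType) : Type := set_type (@copulas R).

HB.instance Definition _ (R : realType) :=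
  Uniform.copy (copula R) (set_type (@copulas R)).

Section copula_theory.
Context {R : realType}.
Implicit Types (C D : copula R) (t : {i01 R}).

Definition copula_fun C : R * R -> R := set_val C.

Coercion copula_fun : copula >-> Funclass.

Lemma copula_funP C : is_copula C.
Proof. exact: set_valP. Qed.

Definition Copula (f : R * R -> R) (fP : is_copula f) : copula R :=
  exist (fun g => g \in copulas) f (mem_set fP).

Definition on_square (f : R * R -> R) : R * R -> R := f \_ unit_square.

Lemma on_squareE (f : R * R -> R) (u v : R) :
  0 <= u <= 1 -> 0 <= v <= 1 -> on_square f (u, v) = f (u, v).
Proof.
move=> u01 v01; by rewrite /on_square patchE mem_set//; split; rewrite /= in_itv.
Qed.

Lemma on_square_copula (f : R * R -> R) :
  (forall v, 0 <= v <= 1 -> f (0, v) = 0) ->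
  (forall u, 0 <= u <= 1 -> f (u, 0) = 0) ->
  (forall u, 0 <= u <= 1 -> f (u, 1) = u) ->
  (forall v, 0 <= v <= 1 -> f (1, v) = v) ->
  (forall u1 u2 v1 v2,
    0 <= u1 -> u1 <= u2 -> u2 <= 1 -> 0 <= v1 -> v1 <= v2 -> v2 <= 1 ->
    0 <= f (u2, v2) - f (u2, v1) - f (u1, v2) + f (u1, v1)) ->
  is_copula (on_square f).
Proof.
move=> f1 f2 f3 f4 f5; split.
- by move=> p np; rewrite /on_square patchE memNset.
- by move=> v v01; rewrite on_squareE ?f1// lexx ler01.
- by move=> u u01; rewrite on_squareE ?f2// lexx ler01.
- by move=> u u01; rewrite on_squareE ?f3// lexx ler01.
- by move=> v v01; rewrite on_squareE ?f4// lexx ler01.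
- move=> u1 u2 v1 v2 h1 h2 h3 h4 h5 h6.
  have hu1 : 0 <= u1 <= 1 by apply/andP; split; lra.
  have hu2 : 0 <= u2 <= 1 by apply/andP; split; lra.
  have hv1 : 0 <= v1 <= 1 by apply/andP; split; lra.
  have hv2 : 0 <= v2 <= 1 by apply/andP; split; lra.
  by rewrite !on_squareE//; exact: f5.
Qed.

Lemma copM_subproof :
  is_copula (on_square (fun p => Num.min p.1 p.2)).
Proof.
apply: on_square_copula => /=.
- by move=> v /andP[? ?]; rewrite minEle; case: leP; lra.
- by move=> u /andP[? ?]; rewrite minEle; case: leP; lra.
- by move=> u /andP[? ?]; rewrite minEle; case: leP; lra.
- by move=> v /andP[? ?]; rewrite minEle; case: leP; lra.
- move=> u1 u2 v1 v2 *; rewrite !minEle.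
  by case: (leP u2 v2) => ?; case: (leP u2 v1) => ?; case: (leP u1 v2) => ?;
    case: (leP u1 v1) => ?; lra.
Qed.

Lemma copW_subproof :
  is_copula (on_square (fun p => Num.max (p.1 + p.2 - 1) 0)).
Proof.
apply: on_square_copula => /=.
- by move=> v /andP[? ?]; rewrite maxEle; case: leP; lra.
- by move=> u /andP[? ?]; rewrite maxEle; case: leP; lra.
- by move=> u /andP[? ?]; rewrite maxEle; case: leP; lra.
- by move=> v /andP[? ?]; rewrite maxEle; case: leP; lra.
- move=> u1 u2 v1 v2 *; rewrite !maxEle.
  by case: (leP (u2 + v2 - 1) 0) => ?; case: (leP (u2 + v1 - 1) 0) => ?;
    case: (leP (u1 + v2 - 1) 0) => ?; case: (leP (u1 + v1 - 1) 0) => ?; lra.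
Qed.

Lemma copPi_subproof : is_copula (on_square (fun p => p.1 * p.2)).
Proof.
apply: on_square_copula => /=.
- by move=> v _; lra.
- by move=> u _; lra.
- by move=> u _; lra.
- by move=> v _; lra.
- move=> u1 u2 v1 v2 *.
  have -> : u2 * v2 - u2 * v1 - u1 * v2 + u1 * v1 = (u2 - u1) * (v2 - v1).
    by lra.
  by apply: mulr_ge0; lra.
Qed.

Definition copM : copula R := Copula copM_subproof.
Definition copW : copula R := Copula copW_subproof.
Definition copPi : copula R := Copula copPi_subproof.

Lemma mix_subproof t C D :
  is_copula (fun p => (1 - t%:num) * C p + t%:num * D p).
Proof.
have [Co Cl Cr C1 C2 Ci] := copula_funP C.
have [Do Dl Dr D1 D2 Di] := copula_funP D.
have t0 : 0 <= t%:num by [].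
have t1 : t%:num <= 1 by [].
split.
- by move=> p np; rewrite Co// Do//; lra.
- by move=> v v01; rewrite Cl// Dl//; lra.
- by move=> u u01; rewrite Cr// Dr//; lra.
- by move=> u u01; rewrite C1// D1//; lra.
- by move=> v v01; rewrite C2// D2//; lra.
- move=> u1 u2 v1 v2 h1 h2 h3 h4 h5 h6.
  have /(mulr_ge0 t0) := Di _ _ _ _ h1 h2 h3 h4 h5 h6.
  have s0 : 0 <= 1 - t%:num by rewrite subr_ge0.
  have /(mulr_ge0 s0) := Ci _ _ _ _ h1 h2 h3 h4 h5 h6.
  by lra.
Qed.

(* (1 - t) C + t D *)
Definition mix t C D : copula R := Copula (mix_subproof t C D).

Definition cop_le C D := forall p, unit_square p -> C p <= D p.

(* The Borel probability measure of C on the square, as a measure on the plane;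
   the condition at (1, 1) forces it to be concentrated on the unit square. *)
Definition is_copula_measure C (P : probability (R * R)%type R) :=
  forall u v : R, 0 <= u <= 1 -> 0 <= v <= 1 ->
    P (`[0, u] `*` `[0, v]) = (C (u, v))%:E.

(* Such a measure exists for every copula and is unique on Borel sets, so the
   default value of xget plays no role. *)
Definition mu C : probability (R * R)%type R :=
  xget point [set P | is_copula_measure C P].

Definition Q C D : R := 4 * (\int[mu D]_(p in unit_square) C p) - 1.

Definition sym_pi (p : R * R) : R * R := (p.2, p.1).
Definition sym_sigma1 (p : R * R) : R * R := (1 - p.1, p.2).

(* The group generated by sym_pi and sym_sigma1: both are involutions, so
   closure under composition suffices. *)
Inductive D4 : (R * R -> R * R) -> Prop :=
| D4_id : D4 id
| D4_pi : D4 sym_pi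
| D4_sigma1 : D4 sym_sigma1
| D4_comp g h : D4 g -> D4 h -> D4 (g \o h).

(* C^gamma, the copula whose measure is the pushforward of mu C; for gamma in
   D4 it exists and is unique, so the default value of xget plays no role. *)
Definition act C (g : R * R -> R * R) : copula R :=
  xget C [set D | forall A, measurable A -> mu D A = pushforward (mu C) g A].

Record measure_of_concordance (kappa : copula R -> R) : Prop := {
  mc_A1 : forall C, kappa (act C sym_pi) = kappa C ;
  mc_A2 : forall C D, cop_le C D -> kappa C <= kappa D ;
  mc_A3 : kappa copM = 1 ;
  mc_A4 : forall C, kappa (act C sym_sigma1) = - kappa C ;
  mc_A5 : forall (C_ : nat -> copula R) C,
    C_ n @[n --> \oo] --> C -> kappa (C_ n) @[n --> \oo] --> kappa C
}.

Definition degree_le2 (kappa : copula R -> R) :=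
  forall C D, exists2 p : {poly R}, (size p <= 3)%N &
    forall t, kappa (mix t C D) = p.[t%:num].

Definition affine_functional (kappa : copula R -> R) :=
  forall t C D, kappa (mix t C D) = (1 - t%:num) * kappa C + t%:num * kappa D.

Definition exact_degree2 (kappa : copula R -> R) :=
  degree_le2 kappa /\ ~ affine_functional kappa.

Definition affine_copula_map (Theta : copula R -> copula R) :=
  forall t C D, Theta (mix t C D) = mix t (Theta C) (Theta D).

Lemma half_ge0 : 0 <= 2^-1 :> R. Proof. by rewrite invr_ge0. Qed.

Lemma half_le1 : 2^-1 <= 1 :> R. Proof. by rewrite invf_le1// ler1n. Qed.

(* The midpoint (C + D) / 2 is mix with parameter 1 / 2. *)
Definition polarization (kappa : copula R -> R) C D : R :=
  2 * kappa (mix (Itv01 half_ge0 half_le1) C D) - (kappa C + kappa D) / 2.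

Definition w (p : R * R) : R := copM p - copW p.

(* Measures on the open square are represented by Borel measures on the plane
   that vanish outside it. *)
Definition Mw_plus (nu : {measure set (R * R) -> \bar R}) :=
  nu (~` open_square) = 0%E /\ (\int[nu]_(p in open_square) (w p)%:E < +oo)%E.

Definition int_dev C (nu : {measure set (R * R) -> \bar R}) : R :=
  \int[nu]_(p in open_square) (C p - copPi p).

Definition kappa_of (nu : copula R -> {measure set (R * R) -> \bar R}) C : R :=
  int_dev C (nu copPi) + int_dev C (nu C).

(* Measures are compared on measurable sets only, since the values of a
   library measure on other sets are irrelevant. *)
Record admissible (nu : copula R -> {measure set (R * R) -> \bar R}) : Prop := {
  adm_P1 : forall C, Mw_plus (nu C) ;
  adm_P2 : forall t C D A, measurable A ->
    nu (mix t C D) A = ((1 - t%:num)%:E * nu C A + (t%:num)%:E * nu D A)%E ;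
  adm_P3 : forall C D,
    int_dev D (nu C) - int_dev D (nu copPi) =
    int_dev C (nu D) - int_dev C (nu copPi) ;
  adm_P4 : forall C g A, D4 g -> measurable A ->
    nu (act C g) A = pushforward (nu C) g A ;
  adm_P5 : continuous (kappa_of nu) ;
  adm_P6 : kappa_of nu copM = 1
}.

Lemma measurable_open_square : measurable (@open_square R).
Proof. by apply: measurableX. Qed.

Definition nu_of (Theta : copula R -> copula R) C :
    {measure set (R * R) -> \bar R} :=
  mscale (4%:R%:nng) (mrestr (mu (Theta C)) measurable_open_square).

End copula_theory.

(* Main.v *)
(* Everything reduces to the biaffine form Q. Two facts about it do the work:
   Q is symmetric, by Fubini on {(x, y) | y <= x} and uniformity of the
   margins, and Q(C^sigma1, D) = - Q(C, D^sigma1), so that Q(Pi, Pi) = 0.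
   Integrating against nu_D gives Q(C, Theta D) - Q(Pi, Theta D), and the second
   term is Q(Pi, D) by (S2) and (S3); hence kappa(C) = Q(Theta C, C), and all
   the axioms follow from symmetry, monotonicity and Lipschitz continuity of Q.
   If kappa were affine, its polarization would give Q(Pi, M) = 1/2, but
   Q(Pi, M) = 4 * (1/3) - 1 = 1/3.

   The measure of a copula is obtained by a conditional quantile transform: for
   fixed q the increments of C(., q) form a measure dominated by the uniform
   law, with density h q increasing in q; the measure of C is the law of
   (u, inf {q | s <= h q u}) when (u, s) is drawn from the subgraphs of h. *)
From HB Require Import structures.
Require Import Defs.
From mathcomp Require Import all_boot all_order all_algebra.
From mathcomp Require Import interval_inference.
From mathcomp Require Import all_classical all_reals all_analysis.
From mathcomp Require Import measurable_realfun.
From mathcomp Require Import lra ring.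
Import Order.TTheory GRing.Theory Num.Theory.
Import numFieldNormedType.Exports.
Local Open Scope classical_set_scope.
Local Open Scope ring_scope.
Set Implicit Arguments.
Unset Strict Implicit.
Unset Printing Implicit Defensive.

(** * Distribution functions on the line and on the plane *)

Section clamp.
Context {R : realType}.
Implicit Types (x y : R).

(** The distribution function of the uniform law on the unit interval, hence the margin of every
    copula once it is extended to the plane. *)
Definition clamp x : R := Num.max 0 (Num.min x 1).

Lemma clampK x : 0 <= x <= 1 -> clamp x = x.
Proof. by move=> /andP[x0 x1]; rewrite /clamp min_l// max_r. Qed.

Lemma clamp_le0 x : x <= 0 -> clamp x = 0.
Proof. by move=> x0; rewrite /clamp max_l// ge_min x0. Qed.

Lemma clamp_ge1 x : 1 <= x -> clamp x = 1.
Proof. by move=> x1; rewrite /clamp min_r// max_r. Qed.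

Lemma clamp01 x : 0 <= clamp x <= 1.
Proof. by rewrite /clamp le_max ge_max ge_min !lexx ler01 orbT. Qed.

Lemma clamp_ge0 x : 0 <= clamp x. Proof. by case/andP: (clamp01 x). Qed.

Lemma clamp_le1 x : clamp x <= 1. Proof. by case/andP: (clamp01 x). Qed.

Variant clamp_spec x : R -> Type :=
| ClampLe0 of x <= 0 : clamp_spec x 0
| ClampIn of 0 < x < 1 : clamp_spec x x
| ClampGe1 of 1 <= x : clamp_spec x 1.

Lemma clampP x : clamp_spec x (clamp x).
Proof.
have [x0|x0] := leP x 0; first by rewrite clamp_le0//; constructor.
have [x1|x1] := leP 1 x; first by rewrite clamp_ge1//; constructor.
by rewrite clampK ?ltW//; constructor; rewrite x0.
Qed.

Lemma le_clamp x y : x <= y -> clamp x <= clamp y.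
Proof. by case: (clampP x) => ?; case: (clampP y) => ?; lra. Qed.

Lemma clamp_lip x y : x <= y -> clamp y - clamp x <= y - x.
Proof. by case: (clampP x) => ?; case: (clampP y) => ?; lra. Qed.

End clamp.

Section copula_values.
Context {R : realType}.
Implicit Types (C D : copula R) (u v : R).

Lemma copula_ext C D :
  (forall u v, 0 <= u <= 1 -> 0 <= v <= 1 -> C (u, v) = D (u, v)) -> C = D.
Proof.
move=> CD; apply: val_inj; apply/funext => -[u v].
rewrite -[LHS]/(C (u, v)) -[RHS]/(D (u, v)).
have [[/= u01 v01]|np] := pselect (unit_square (u, v)).
  by rewrite !in_itv/= in u01 v01; exact: CD.
by rewrite (copula_out (copula_funP C) np) (copula_out (copula_funP D) np).
Qed.

(** The extension of a copula to the plane as the distribution function of its measure. Unlike the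
    extension by zero, it keeps monotonicity and 2-increase with no range conditions. *)
Definition cext C u v : R := C (clamp u, clamp v).

Lemma cextE C u v : 0 <= u <= 1 -> 0 <= v <= 1 -> cext C u v = C (u, v).
Proof. by move=> u01 v01; rewrite /cext !clampK. Qed.

Lemma cext_2incr C u1 u2 v1 v2 : u1 <= u2 -> v1 <= v2 ->
  0 <= cext C u2 v2 - cext C u2 v1 - cext C u1 v2 + cext C u1 v1.
Proof.
move=> u12 v12; apply: (copula_2incr (copula_funP C));
  by rewrite ?clamp_ge0 ?clamp_le1 ?le_clamp.
Qed.

Lemma cext_le0l C u v : u <= 0 -> cext C u v = 0.
Proof.
by move=> u0; rewrite /cext (clamp_le0 u0) (copula_groundl (copula_funP C))// clamp01.
Qed.

Lemma cext_le0r C u v : v <= 0 -> cext C u v = 0.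
Proof.
by move=> u0; rewrite /cext (clamp_le0 u0) (copula_groundr (copula_funP C))// clamp01.
Qed.

Lemma cext_ge1l C u v : 1 <= u -> cext C u v = clamp v.
Proof.
by move=> u0; rewrite /cext (clamp_ge1 u0) (copula_marginr (copula_funP C))// clamp01.
Qed.

Lemma cext_ge1r C u v : 1 <= v -> cext C u v = clamp u.
Proof.
by move=> u0; rewrite /cext (clamp_ge1 u0) (copula_marginl (copula_funP C))// clamp01.
Qed.

Lemma cext_ndl C v u1 u2 : u1 <= u2 -> cext C u1 v <= cext C u2 v.
Proof.
move=> u12; have [v0|v0] := leP v 0; first by rewrite !cext_le0r.
by have := cext_2incr C u12 (ltW v0); rewrite !(@cext_le0r _ _ 0)//; lra.
Qed.

(** The rectangle between heights [v] and [1] has non-negative mass, and at height [1] the increment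
    is that of [clamp]. *)
Lemma cext_lipl C v u1 u2 : u1 <= u2 ->
  cext C u2 v - cext C u1 v <= clamp u2 - clamp u1.
Proof.
move=> u12; have [v1|v1] := leP 1 v; first by rewrite !cext_ge1r.
by have := cext_2incr C u12 (ltW v1); rewrite !(@cext_ge1r _ _ 1)//; lra.
Qed.

Lemma cext_lipr C u v1 v2 : v1 <= v2 ->
  cext C u v2 - cext C u v1 <= clamp v2 - clamp v1.
Proof.
move=> v12; have [u1|u1] := leP 1 u; first by rewrite !cext_ge1l.
by have := cext_2incr C (ltW u1) v12; rewrite !(@cext_ge1l _ 1)//; lra.
Qed.

Lemma cext_ge0 C u v : 0 <= cext C u v.
Proof.
have [u0|u0] := leP u 0; first by rewrite cext_le0l.
by rewrite -(@cext_le0l C 0 v)// cext_ndl// ltW.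
Qed.

Lemma cext_le1 C u v : cext C u v <= 1.
Proof.
have [u0|u0] := leP 1 u; first by rewrite cext_ge1l ?clamp_le1.
by rewrite (le_trans (cext_ndl _ _ (ltW u0)))// cext_ge1l// clamp_le1.
Qed.

End copula_values.


Section push.
Context d1 d2 (T1 : measurableType d1) (T2 : measurableType d2) (R : realType).

Definition push (m : {measure set T1 -> \bar R}) (f : T1 -> T2)
  (mf : measurable_fun setT f) : {measure set T2 -> \bar R} :=
  @measure_function_pushforward__canonical__measure_function_Measure
     _ _ _ _ _ m f mf.

Lemma pushE m f (mf : measurable_fun setT f) A :
  push m mf A = m (f @^-1` A).
Proof. by []. Qed.

Lemma push_mrestrE (m : {measure set T1 -> \bar R}) D (mD : measurable D)
  f (mf : measurable_fun setT f) A :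
  push (mrestr m mD) mf A = m (f @^-1` A `&` D).
Proof. by []. Qed.

End push.

Section measure_probability.
Context d (T : measurableType d) (R : realType).
Variables (m : {measure set T -> \bar R}) (mT : m setT = 1%E).

(** The alias carries the proof of total mass one, so that a probability structure can be attached
    to it. *)
Definition normalized (_ : m setT = 1%E) : set T -> \bar R := m.

HB.instance Definition _ := Measure.copy (normalized mT) m.

HB.instance Definition _ :=
  Measure_isProbability.Build _ _ _ (normalized mT) mT.

Lemma measure_probability : exists P : probability T R, forall A, P A = m A.
Proof. by exists (normalized mT). Qed.

End measure_probability.



Section quadrants.
Context {R : realType}.
Implicit Types (u v : R).

Definition quad u v : set (R * R) := `]-oo, u] `*` `]-oo, v].

Lemma measurable_quad u v : measurable (quad u v).
Proof. exact: measurableX. Qed.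


(** Half-open intervals are stable under intersection, generate the Borel sets and exhaust the line
    through []-n, n]]. *)
Lemma ocitv_unique (m1 m2 : {measure set R -> \bar R}) :
  (forall a b, (m1 `]a, b]%classic < +oo)%E) ->
  (forall a b, a <= b -> m1 `]a, b]%classic = m2 `]a, b]%classic) ->
  forall A, measurable A -> m1 A = m2 A.
Proof.
move=> fin1 m12 A mA.
pose G : set (set R) := @ocitv R.
have GE : measurable = <<s G >> by [].
pose g n : set R := `](- n%:R), n%:R]%classic.
apply: (measure_unique G g GE) => //.
- exact: ocitvI.
- by move=> n; exact: is_ocitv.
- by apply/seteqP; split => // x _; rewrite bigcup_itvT.
- move=> X [[a b] _ <-]/=; have [ab|ba] := leP a b; first exact: m12.
  by rewrite set_itv_ge ?measure0// bnd_simp -leNgt ltW.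
- by move=> n; exact: fin1.
Qed.

Lemma ocitvE (m : {measure set R -> \bar R}) a b : a <= b ->
  (m `]-oo, b]%classic < +oo)%E ->
  (m `]a, b]%classic = m `]-oo, b]%classic - m `]-oo, a]%classic)%E.
Proof.
move=> ab mb.
have -> : `]a, b]%classic = `]-oo, b]%classic `\` `]-oo, a]%classic.
  by rewrite -[RHS]setCK setCD setCitvl setUC -[LHS]setCK setCitv.
rewrite measureD//; congr (_ - m _)%E.
by rewrite setIidr//; exact: subset_itvl.
Qed.

Lemma finite_measureR_unique (m1 m2 : {measure set R -> \bar R}) :
  (m1 setT < +oo)%E ->
  (forall x, m1 `]-oo, x]%classic = m2 `]-oo, x]%classic) ->
  forall A, measurable A -> m1 A = m2 A.
Proof.
move=> m1oo m12.
have fin1 X : measurable X -> (m1 X < +oo)%E.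
  by move=> mX; rewrite (le_lt_trans _ m1oo)// le_measure ?inE.
apply: ocitv_unique => a b; first by apply: fin1; exact: measurable_itv.
move=> ab; have m1b := fin1 _ (measurable_itv `]-oo, b]).
have m2b : (m2 `]-oo, b]%classic < +oo)%E by rewrite -m12.
by rewrite ocitvE// ocitvE//; congr (_ - _)%E; exact: m12.
Qed.

Lemma preimage_fst_setX (B : set R) (A : set R) :
  fst @^-1` A `&` (setT `*` B) = A `*` B.
Proof. by rewrite predeqE => -[x y] /=; tauto. Qed.

Lemma preimage_snd_setX (B : set R) (A : set R) :
  snd @^-1` B `&` (A `*` setT) = A `*` B.
Proof. by rewrite predeqE => -[x y] /=; tauto. Qed.

(** One coordinate at a time: with a half-line fixed in the second coordinate, both sides are finite
    measures of the first one; with a Borel set then fixed in the first, they are finite measures of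
    the second. Rectangles finally generate the product. *)
Lemma quad_unique (m1 m2 : {measure set (R * R) -> \bar R}) :
  (m1 setT < +oo)%E ->
  (forall u v, m1 (quad u v) = m2 (quad u v)) ->
  forall A, measurable A -> m1 A = m2 A.
Proof.
move=> m1oo m12.
have fin1 X : measurable X -> (m1 X < +oo)%E.
  by move=> mX; rewrite (le_lt_trans _ m1oo)// le_measure ?inE.
have mT v : measurable ([set: R] `*` `]-oo, v]%classic) by exact: measurableX.
have step1 A v : measurable A ->
    m1 (A `*` `]-oo, v]%classic) = m2 (A `*` `]-oo, v]%classic).
  move=> mA.
  pose n1 := push (mrestr m1 (mT v)) measurable_fst.
  pose n2 := push (mrestr m2 (mT v)) measurable_fst.
  suff : n1 A = n2 A by rewrite !push_mrestrE preimage_fst_setX.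
  apply: finite_measureR_unique => //.
  - by rewrite push_mrestrE (preimage_fst_setX _ setT); apply: fin1; exact: measurableX.
  - by move=> x; rewrite !push_mrestrE preimage_fst_setX; exact: m12.
have step2 A B : measurable A -> measurable B -> m1 (A `*` B) = m2 (A `*` B).
  move=> mA mB.
  have mAT : measurable (A `*` [set: R]) by exact: measurableX.
  pose n1 := push (mrestr m1 mAT) measurable_snd.
  pose n2 := push (mrestr m2 mAT) measurable_snd.
  suff : n1 B = n2 B by rewrite !push_mrestrE preimage_snd_setX.
  apply: finite_measureR_unique => //.
  - by rewrite push_mrestrE (preimage_snd_setX setT); apply: fin1; exact: measurableX.
  - by move=> x; rewrite !push_mrestrE preimage_snd_setX; exact: step1.
move=> X mX.
apply: (measure_unique [set A `*` B | A in measurable & B in measurable]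
  (fun=> setT)) => //.
- exact: measurable_prod_measurableType.
- move=> _ _ [A mA [B mB <-]] [A' mA' [B' mB' <-]].
  exists (A `&` A'); first exact: measurableI.
  by exists (B `&` B'); [exact: measurableI|rewrite setXI].
- by move=> _; exists setT => //; exists setT => //; rewrite setXTT.
- by rewrite bigcup_const//; exists 0%N.
- by move=> _ [A mA [B mB <-]]; exact: step2.
Qed.

End quadrants.

(** * Existence of the measure of a copula *)

(* The library keeps two copies of the Borel sigma-algebra of the line, with
   distinct displays; its measures live on the first, products and copulas on
   the second. *)
Lemma measurable_toR (R : realType) :
  measurable_fun [set: measurableTypeR R] (id : measurableTypeR R -> R).
Proof. by move=> _ A mA; rewrite setTI. Qed.

(** * Stieltjes measures of Lipschitz functions, and the uniform law *)

Section stieltjes.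
Context {R : realType} (F : R -> R).
Hypothesis F_nd : {homo F : x y / x <= y}.
Hypothesis F_lip : forall x y, x <= y -> F y - F x <= y - x.

Let F_rc (x : R) : F z @[z --> x^'+] --> F x.
Proof.
apply/cvgrPdist_le => e e0; near=> z.
have xz : x <= z by near: z; apply: nbhs_right_ge.
rewrite distrC ger0_norm ?subr_ge0 ?F_nd//.
rewrite (le_trans (F_lip xz))// lerBlDl.
by near: z; apply: nbhs_right_le; rewrite ltrDl.
Unshelve. all: by end_near. Qed.

HB.instance Definition _ := isCumulative.Build R _ R F F_nd F_rc.

(** The Lipschitz bound yields the right continuity that a Stieltjes measure requires; the identity
    then transports the measure to the sigma-algebra used by products. *)
Lemma stieltjes_exists : exists m : {measure set R -> \bar R},
  forall a b, a <= b -> m `]a, b]%classic = (F b - F a)%:E.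
Proof.
exists (push (lebesgue_stieltjes_measure F) (@measurable_toR R)) => a b ab.
suff : lebesgue_stieltjes_measure F `]a, b]%classic = (F b - F a)%:E by [].
rewrite /lebesgue_stieltjes_measure /measure_extension/=.
by rewrite measurable_mu_extE/= ?wlength_itv_bnd//; exact: is_ocitv.
Qed.

End stieltjes.

Section stieltjes_le.
Context {R : realType}.

(** The difference [G - F] is again non-decreasing and Lipschitz, so it has a Stieltjes measure
    [mH], and [mG] is the sum of [mF] and [mH]. *)
Lemma stieltjes_le (F G : R -> R) (mF mG : {measure set R -> \bar R}) :
  {homo F : x y / x <= y} ->
  (forall x y, x <= y -> F y - F x <= G y - G x) ->
  (forall x y, x <= y -> G y - G x <= y - x) ->
  (forall a b, a <= b -> mF `]a, b]%classic = (F b - F a)%:E) ->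
  (forall a b, a <= b -> mG `]a, b]%classic = (G b - G a)%:E) ->
  forall A, measurable A -> (mF A <= mG A)%E.
Proof.
move=> F_nd FG G_lip FE GE A mA.
have H_nd : {homo (fun x => G x - F x) : x y / x <= y}.
  by move=> x y xy; have := FG _ _ xy; lra.
have H_lip x y : x <= y -> (G y - F y) - (G x - F x) <= y - x.
  by move=> xy; have := F_nd _ _ xy; have := G_lip _ _ xy; lra.
have [mH HE] := stieltjes_exists H_nd H_lip.
suff -> : mG A = measure_add mF mH A by rewrite measure_addE leeDl.
apply: ocitv_unique mA => [a b|a b ab].
  have [ab|ba] := leP a b; first by rewrite GE// ltry.
  by rewrite set_itv_ge ?measure0// bnd_simp -leNgt ltW.
rewrite [RHS]measure_addE GE//; move: (FE _ _ ab) (HE _ _ ab) => -> ->.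
by rewrite -EFinD; congr EFin; ring.
Qed.

End stieltjes_le.

Section uniform.
Context {R : realType}.

Lemma unif_exists : exists P : probability R R,
  forall A, P A = uniform_prob (@ltr01 R) A.
Proof.
have mT : push (uniform_prob (@ltr01 R)) (@measurable_toR R) setT = 1%E.
  exact: (probability_setT (uniform_prob (@ltr01 R))).
by have [P PE] := measure_probability mT; exists P => A; rewrite PE.
Qed.

Definition unif : probability R R := sval (cid unif_exists).

Lemma unifE A : unif A = uniform_prob (@ltr01 R) A.
Proof. exact: (svalP (cid unif_exists)). Qed.

Lemma unif_cdf (x : R) : unif `]-oo, x]%classic = (clamp x)%:E.
Proof.
rewrite unifE /uniform_prob integral_uniform_pdf.
have -> : `]-oo, x]%classic `&` `[0, 1]%classic = `[0, Num.min x 1]%classic :> set R.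
  apply/seteqP; split => z /=; rewrite !in_itv/= le_min.
    by move=> [-> /andP[-> ->]].
  by move=> /andP[-> /andP[-> ->]].
rewrite (eq_integral (cst 1%E)); last first.
  move=> z; rewrite inE/= in_itv/= le_min => /andP[z0 /andP[_ z1]].
  by rewrite /uniform_pdf z0 z1/= subr0 invr1.
rewrite integral_cst//= mul1e lebesgue_measure_itv/= lte_fin /clamp.
by rewrite maxElt; case: ifPn => // _; rewrite -EFinD subr0.
Qed.

Lemma unif_itv (a b : R) : a <= b ->
  unif `]a, b]%classic = (clamp b - clamp a)%:E.
Proof.
move=> ab; have fin : (unif `]-oo, b]%classic < +oo)%E.
  by rewrite unif_cdf ltry.
by rewrite EFinB -!unif_cdf; exact: ocitvE ab fin.
Qed.

End uniform.

Section finite_measure_of.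
Context d (T : measurableType d) (R : realType).
Variables (m : {measure set T -> \bar R}) (mT : (m setT < +oo)%E).

Definition bounded_measure (_ : (m setT < +oo)%E) : set T -> \bar R := m.

HB.instance Definition _ := Measure.copy (bounded_measure mT) m.

HB.instance Definition _ :=
  Measure_isFinite.Build _ _ _ (bounded_measure mT) (lty_fin_num_fun mT).

Lemma measure_finite :
  exists n : {finite_measure set T -> \bar R}, forall A, n A = m A.
Proof. by exists (bounded_measure mT). Qed.

End finite_measure_of.

(** * Densities of the horizontal increments of a copula *)

Section density.
Context d (T : measurableType d) (R : realType).

(** Domination by a probability gives both finiteness and absolute continuity, so Radon-Nikodym
    applies. *)
Lemma dominated_density (P : probability T R) (m : {measure set T -> \bar R}) :
  (forall A, measurable A -> (m A <= P A)%E) ->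
  exists h : T -> \bar R, [/\ forall x, (0 <= h x)%E,
    forall x, h x \is a fin_num,
    P.-integrable setT h &
    forall A, measurable A -> m A = (\int[P]_(x in A) h x)%E].
Proof.
move=> mP.
have mT : (m setT < +oo)%E.
  by rewrite (le_lt_trans (mP _ measurableT))// probability_setT ltry.
have [n nm] := measure_finite mT.
have nP : n `<< P.
  apply/null_content_dominatesP => A mA PA0; apply/eqP.
  rewrite -measure_le0 -PA0; apply: le_trans (mP _ mA).
  by rewrite -(nm A).
have [h [h0 hfin ih hE]] := radon_nikodym_sigma_finite nP.
by exists h; split => // A mA; rewrite -nm; exact: hE.
Qed.

End density.

Section copula_density.
Context {R : realType} (C : copula R).

(** The density [h q] is that of the Stieltjes measure of [cext C ^~ q], which the Lipschitz bound
    places below the uniform law. By 2-increase these measures grow with [q], so their densities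
    grow almost everywhere. *)
Lemma copula_density : exists h : R -> R -> \bar R, [/\
  forall q x, (0 <= h q x)%E, forall q x, h q x \is a fin_num,
  forall q, measurable_fun [set: R] (h q),
  forall q u, (\int[unif]_(x in `]-oo, u]) h q x = (cext C u q)%:E)%E &
  forall q r, q <= r -> unif [set x | (h r x < h q x)%E] = 0].
Proof.
have E q := stieltjes_exists (F := fun u => cext C u q) (fun x y => @cext_ndl _ C q x y)
  (fun x y xy => le_trans (cext_lipl C q xy) (clamp_lip xy)).
have [m mE] := choice E.
have mU q A : measurable A -> (m q A <= unif A)%E.
  move=> mA; apply: (@stieltjes_le _ (cext C ^~ q) (@clamp R)) => //.
  - by move=> x y; exact: cext_ndl.
  - by move=> x y; exact: cext_lipl.
  - by move=> x y; exact: clamp_lip.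
  - exact: mE.
  - by move=> a b; exact: unif_itv.
have [h hP] := choice (fun q => dominated_density (@mU q)).
exists h; split.
- by move=> q x; have [] := hP q.
- by move=> q x; have [] := hP q.
- by move=> q; have [_ _ /measurable_int] := hP q.
- move=> q u; have [_ _ _ <-//] := hP q.
  (* The values of [m q] are prescribed on bounded intervals only; domination by the uniform law
     removes any mass left of 0. *)
  have m0 : m q `]-oo, 0]%classic = 0.
    apply/eqP; rewrite -measure_le0 (le_trans (mU _ _ _))//.
    by rewrite unif_cdf clamp_le0.
  have mfin x : (m q `]-oo, x]%classic < +oo)%E.
    by rewrite (le_lt_trans (mU _ _ _))// unif_cdf ltry.
  have [u0|u0] := leP u 0.
    rewrite cext_le0l//; apply/eqP; rewrite -measure_le0 -m0 le_measure ?inE//.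
    by apply: subset_itvl; rewrite bnd_simp.
  have := ocitvE (ltW u0) (mfin u); rewrite m0 sube0 => <-.
  by rewrite mE ?ltW// (@cext_le0l _ _ 0)// subr0.
- move=> q r qr.
  have [hq0 hqf hqi hqE] := hP q; have [hr0 hrf hri hrE] := hP r.
  have mhq := measurable_int _ hqi; have mhr := measurable_int _ hri.
  set N := [set x | _].
  have mN : measurable N.
    by rewrite -[N]setTI; exact: measurable_lte.
  have mqr A : measurable A -> (m q A <= m r A)%E.
    move=> mA; apply: (@stieltjes_le _ (cext C ^~ q) (cext C ^~ r)) => //.
    + by move=> x y; exact: cext_ndl.
    + by move=> x y xy; have := cext_2incr C xy qr; lra.
    + by move=> x y xy; exact: le_trans (cext_lipl C r xy) (clamp_lip xy).
    + exact: mE.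
    + exact: mE.
  (* On subsets of [N] the integral of [h r] is at most that of [h q] pointwise, and at least it by
     [mqr]. So the two densities agree almost everywhere on [N], where they differ strictly; hence
     [N] is null. *)
  have : ae_eq unif N (h q) (h r).
    apply: integral_ae_eq => //.
    + exact: integrableS hqi.
    + exact: measurable_funTS mhr.
    + move=> A AN mA; apply/eqP; rewrite eq_le -{1}hqE// -{1}hrE// mqr//=.
      apply: ge0_le_integral => //.
      * exact: measurable_funTS mhr.
      * exact: measurable_funTS mhq.
      * by move=> x /AN /ltW.
  case=> M [mM M0 NM]; apply/eqP; rewrite -measure_le0 -M0 le_measure ?inE//.
  by move=> x Nx; apply: NM => /= /(_ Nx) hqr; move: Nx; rewrite /N/= hqr ltxx.
Qed.

End copula_density.

(** * The conditional quantile transform *)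

Section copula_measure_exists.
Context {R : realType} (C : copula R).
Local Notation L := (measurableTypeR R).
Variable h : R -> R -> \bar R.
Hypothesis h_ge0 : forall q x, (0 <= h q x)%E.
Hypothesis h_fin : forall q x, h q x \is a fin_num.
Hypothesis h_meas : forall q, measurable_fun [set: R] (h q).
Hypothesis h_int : forall q u,
  (\int[unif]_(x in `]-oo, u]) h q x = (cext C u q)%:E)%E.
Hypothesis h_mono : forall q r, q <= r ->
  unif [set x | (h r x < h q x)%E] = 0.

Let Pi : {measure set (R * L) -> \bar R} := (unif \x (@lebesgue_measure R))%E.

Let sndR (p : R * L) : R := p.2.

(** The subgraph of [h q]: its section over [x] has length [h q x], so its area left of [u] is
    [cext C u q]. *)
Let S (q : R) : set (R * L) :=
  [set p | 0 < sndR p /\ ((sndR p)%:E <= h q p.1)%E].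

Let measurable_sndR : measurable_fun [set: R * L] sndR.
Proof. exact: (measurableT_comp (@measurable_toR R) measurable_snd). Qed.

Let mS q : measurable (S q).
Proof.
apply: measurableI.
  have := measurable_sndR measurableT (measurable_itv `]0, +oo[).
  rewrite setTI; congr measurable.
  by apply/seteqP; split => p /=; rewrite in_itv/= andbT.
rewrite -[X in measurable X]setTI; apply: measurable_lee => //.
  exact: (measurableT_comp (@EFin_measurable _ _) measurable_sndR).
exact: measurableT_comp (h_meas q) measurable_fst.
Qed.

Let strip (A : set R) : set (R * L) := fst @^-1` A.

Let mstrip A : measurable A -> measurable (strip A).
Proof. by move=> mA; rewrite -[strip A]setTI; exact: measurable_fst. Qed.

Let Pi_strip q (u : R) : Pi (S q `&` strip `]-oo, u]) = (cext C u q)%:E.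
Proof.
rewrite /Pi /product_measure1/= -h_int [RHS]integral_mkcond.
apply: eq_integral => x _ /=; rewrite patchE.
case: ifPn => [|]; rewrite ?inE ?notin_setE => xu.
  have -> : xsection (S q `&` strip `]-oo, u]) x =
      `]0, fine (h q x)]%classic :> set R.
    apply/seteqP; split => s; rewrite /xsection/= inE.
      by move=> [[/= s0 sh] _]; rewrite in_itv/= s0 -lee_fin fineK.
    rewrite /= in_itv/= => /andP[s0 sh]; split => //.
    by split => //=; rewrite -(fineK (h_fin q x)) lee_fin.
  rewrite lebesgue_measure_itv/= lte_fin; case: ifPn.
    by rewrite oppr0 adde0 fineK.
  rewrite -leNgt => h0; apply/eqP; rewrite eq_le h_ge0/= -(fineK (h_fin q x)).
  by rewrite lee_fin.
have -> : xsection (S q `&` strip `]-oo, u]) x = set0.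
  by apply/seteqP; split => s //; rewrite /xsection/= inE => -[_ /xu].
by rewrite measure0.
Qed.

Let Pi_null A : measurable A -> unif A = 0 -> Pi (strip A) = 0.
Proof.
move=> mA A0; have -> : strip A = A `*` setT.
  by rewrite predeqE => -[x y]; rewrite /strip/=; tauto.
transitivity (unif A * lebesgue_measure [set: L])%E; last by rewrite A0 mul0e.
exact: product_measure1E.
Qed.

(** Rational levels make the exceptional sets a countable union; the level 1 is included so that [E]
    carries the full mass. *)
Let I : set rat := [set q | 0 < (ratr q : R) <= 1].

Let E : set (R * L) := \bigcup_(q in I) S (ratr q).

Let bigS (J : set rat) : measurable (\bigcup_(q in J) S (ratr q)).
Proof.
by rewrite bigcup_mkcond; apply: bigcupT_measurable_rat => q; case: ifP.
Qed.

(** The abscissas where [h] fails to increase from some rational level up to [r]. *)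
Let N r : set R := \bigcup_(q in [set q : rat | (ratr q : R) <= r])
  [set x | (h r x < h (ratr q) x)%E].

Let mlt r q : measurable [set x | (h r x < h q x)%E].
Proof. by rewrite -[X in measurable X]setTI; exact: measurable_lte. Qed.

Let mN r : measurable (N r).
Proof.
rewrite /N bigcup_mkcond; apply: bigcupT_measurable_rat => q.
by case: ifP => // _.
Qed.

Let N0 r : unif (N r) = 0.
Proof.
apply/negligibleP => //.
pose F n := if unpickle n is Some q then
  (if (ratr q : R) <= r then [set x | (h r x < h (ratr q) x)%E] else set0)
  else set0.
apply: (@negligibleS _ _ _ _ (\bigcup_n F n)).
  move=> x [q /= qr hq]; exists (pickle q); first by [].
  by rewrite /F pickleK qr; exact: hq.
apply: negligible_bigcup => n; rewrite /F.
case: unpickle => [q|]; last exact: negligible_set0.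
case: ifP => qr; last exact: negligible_set0.
by apply/negligibleP => //; exact: h_mono.
Qed.

Let bigS_sub (J : set rat) r : (forall q, J q -> (ratr q : R) <= r) ->
  \bigcup_(q in J) S (ratr q) `<=` S r `|` strip (N r).
Proof.
move=> Jr p [q Jq [p0 pq]].
have [hh|hh] := leP (h (ratr q) p.1) (h r p.1).
  by left; split => //; exact: le_trans hh.
by right; exists q => //; exact: Jr.
Qed.

(** Apart from the null strip over [N r], all subgraphs at levels up to [r] lie inside [S r]. *)
Let Pi_bigS (J : set rat) r u : (forall q, J q -> (ratr q : R) <= r) ->
  (Pi ((\bigcup_(q in J) S (ratr q)) `&` strip `]-oo, u]) <= (cext C u r)%:E)%E.
Proof.
move=> Jr.
have mstripu : measurable (strip `]-oo, u]) by apply: mstrip; exact: measurable_itv.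
rewrite -Pi_strip -[leRHS]adde0 -(Pi_null (mN r) (N0 r)).
apply: (@le_trans _ _ (Pi ((S r `&` strip `]-oo, u]) `|` strip (N r)))).
  apply: le_measure; rewrite ?inE.
  - exact: measurableI.
  - by apply: measurableU; [exact: measurableI|exact: mstrip].
  - move=> p [/(bigS_sub Jr)[Sp|Np] pu]; first by left.
    by right.
apply: measureU2; first exact: measurableI.
exact: mstrip.
Qed.

(** The conditional quantile: the infimum of the rational levels whose subgraph contains the point.
    Outside [E] the set is empty and [inf] returns its default value 0. *)
Let G (p : R * L) : R :=
  inf [set (ratr q : R) | q in [set q | I q /\ S (ratr q) p]].

Let Gle p q : I q -> S (ratr q) p -> G p <= ratr q.
Proof.
move=> Iq Sq; apply: ge_inf; last by exists q.
by exists 0 => _ [r [/andP[/ltW r0 _] _] <-].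
Qed.

Let Glt p x : E p -> (G p < x) =
  `[< exists q, [/\ I q, S (ratr q) p & (ratr q : R) < x] >].
Proof.
move=> [q Iq Sq]; apply/idP/asboolP.
  move=> Gx; have [|_ [r [Ir Sr] <-] rx] := inf_lt _ Gx; last by exists r.
  by exists (ratr q); exists q.
by move=> [r [Ir Sr]]; apply: le_lt_trans; exact: Gle.
Qed.

Let GnE p : ~ E p -> G p = 0.
Proof.
move=> nE; rewrite /G (_ : image _ _ = set0) ?inf0//.
by apply/seteqP; split => // x [r [Ir Sr] _]; apply: nE; exists r.
Qed.

Let mG : measurable_fun [set: R * L] G.
Proof.
apply: (measurability _ (RGenInftyO.measurableE R)) => _ [_ [x ->] <-].
rewrite setTI.
(* The default value 0 of [G] off [E] lies below [x] exactly when [x] is positive, which accounts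
   for the second member of the union. *)
rewrite (_ : _ @^-1` _ = (\bigcup_(q in [set q | I q /\ (ratr q : R) < x]) S (ratr q))
   `|` (if 0 < x then ~` E else set0)); last first.
  apply/seteqP; split => p; rewrite /= in_itv/=.
    have [Ep|nE] := pselect (E p).
      by rewrite Glt// => /asboolP[q [Iq Sq qx]]; left; exists q.
    by rewrite GnE// => x0; right; rewrite x0.
  move=> [[q [Iq qx] Sq]|].
    by apply: le_lt_trans qx; exact: Gle.
  by case: ifPn => // x0 nE; rewrite GnE.
apply: measurableU => //; case: ifP => // _; apply: measurableC; exact: bigS.
Qed.

Let mE : measurable E. Proof. exact: bigS. Qed.

Let phi (p : R * L) : R * R := (p.1, G p).

Let mphi : measurable_fun [set: R * L] phi.
Proof. by apply/measurable_fun_pairP; split => //; exact: measurable_fst. Qed.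

Let P0 : {measure set (R * R) -> \bar R} := push (mrestr Pi mE) mphi.

Let P0E A : P0 A = Pi (phi @^-1` A `&` E). Proof. by []. Qed.

(** Where [G] is at most [v], the point lies in a subgraph of level below any [q] above [v];
    conversely [S q] with [q] at most [v] forces [G] to be at most [v]. This squeezes the mass
    between values of [cext C u] at rational levels near [v], and the Lipschitz bound closes the
    gap. *)
Let P0_quad u v : P0 (quad u v) = (cext C u v)%:E.
Proof.
rewrite P0E.
have mm : measurable (phi @^-1` quad u v `&` E).
  apply: measurableI => //; rewrite -[X in measurable X]setTI; apply: mphi => //.
  exact: measurable_quad.
have mstripu : measurable (strip `]-oo, u]) by apply: mstrip; exact: measurable_itv.
(* When [v] is at least 1, no level of [I] exceeds it; the level 1 serves instead, since it bounds
   all levels of [I]. *)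
have upper q : I q -> (v < ratr q \/ 1 <= v /\ ratr q = 1 :> R) ->
    (Pi (phi @^-1` quad u v `&` E) <= (cext C u (ratr q))%:E)%E.
  move=> Iq vq.
  pose J := [set r : rat | I r /\ (ratr r : R) <= ratr q].
  have Jq r : J r -> (ratr r : R) <= ratr q by case.
  apply: le_trans (Pi_bigS u Jq).
  apply: le_measure; rewrite ?inE//.
    by apply: measurableI => //; exact: bigS.
  move=> p [[/= pu pG] Ep]; split => //.
  case: vq => [vq|[v1 q1]].
    have : G p < ratr q by apply: le_lt_trans vq; move: pG; rewrite in_itv.
    by rewrite Glt// => /asboolP[r [Ir Sr rq]]; exists r => //; split => //; exact: ltW.
  case: Ep => r Ir Sr; exists r => //; split => //.
  by rewrite q1; case/andP: Ir.
have lower q : I q -> ratr q <= v ->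
    ((cext C u (ratr q))%:E <= Pi (phi @^-1` quad u v `&` E))%E.
  move=> Iq qv; rewrite -Pi_strip; apply: le_measure; rewrite ?inE//.
    exact: measurableI.
  move=> p [Sp pu]; split; last by exists q.
  by split => //=; rewrite in_itv/= (le_trans _ qv)//; exact: Gle.
have r1 : ratr 1 = 1 :> R by rewrite rmorph1.
have I1 : I 1 by rewrite /I/= r1 ltr01 lexx.
have [v1|v1] := leP 1 v.
  apply/eqP; rewrite eq_le; apply/andP; split.
    rewrite [cext _ _ _]cext_ge1r// -(@cext_ge1r _ C u 1)// -r1.
    by apply: upper => //; right.
  rewrite [cext _ _ _]cext_ge1r// -(@cext_ge1r _ C u 1)// -r1.
  by apply: lower => //; rewrite r1.
apply/eqP; rewrite eq_le; apply/andP; split.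
  apply/lee_addgt0Pr => e e0.
  (* These endpoints keep [q] in [I], above [v], and within [e] of [Num.max v 0], so that the
     Lipschitz bound costs at most [e]. *)
  have := @rat_in_itvoo _ (Num.max v 0) (Num.min 1 (Num.max v 0 + e)).
  rewrite lt_min ltrDl e0 andbT gt_max v1 ltr01/= => /(_ isT)[q].
  rewrite in_itv/= lt_min gt_max => /andP[/andP[vq q0] /andP[q1 qe]].
  apply: (le_trans (upper q _ _)); [by rewrite /I/= q0 ltW|by left|].
  rewrite -EFinD lee_fin.
  have [v0|v0] := leP v 0.
    have := cext_lipr C u (ltW q0); have := clamp_lip (ltW q0).
    rewrite (@cext_le0r _ C u 0)// (@cext_le0r _ C u v)//.
    by move: qe; rewrite max_r//; lra.
  have := cext_lipr C u (ltW vq); have := clamp_lip (ltW vq).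
  by move: qe; rewrite max_l ?(ltW v0)//; lra.
have [v0|v0] := leP v 0; first by rewrite cext_le0r.
apply/lee_addgt0Pr => e e0.
have := @rat_in_itvoo _ (Num.max 0 (v - e)) v.
rewrite gt_max v0 gtrBl e0 => /(_ isT)[q].
rewrite in_itv/= gt_max => /andP[/andP[q0 qe] qv].
rewrite -leeBlDr//; apply: le_trans (lower q _ (ltW qv)).
  rewrite -EFinB lee_fin.
  by have := cext_lipr C u (ltW qv); have := clamp_lip (ltW qv); lra.
by rewrite /I/= q0 ltW// (lt_trans qv).
Qed.

(** The quadrant at [(1, 1)] already has mass 1; nothing is added beyond it, because abscissas above
    1 are null for the uniform law and all levels in [I] are at most 1. *)
Let P0T : P0 setT = 1%E.
Proof.
apply/eqP; rewrite eq_le; apply/andP; split; last first.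
  apply: (@le_trans _ _ (P0 (quad 1 1))).
    by rewrite P0_quad cext_ge1r// clampK ?lexx ?ler01.
  by apply: le_measure; rewrite ?inE//; exact: measurable_quad.
have mI1 : measurable (`]1, +oo[%classic : set R) by exact: measurable_itv.
have I10 : unif (`]1, +oo[%classic : set R) = 0.
  rewrite -[X in unif X]setCK setCitvr probability_setC ?unif_cdf.
    by rewrite clampK ?lexx ?ler01// subee.
  exact: measurable_itv.
have mstripu : measurable (strip `]-oo, 1]) by apply: mstrip; exact: measurable_itv.
apply: (@le_trans _ _ (Pi ((E `&` strip `]-oo, 1]) `|` strip `]1, +oo[))).
  rewrite P0E preimage_setT setTI; apply: le_measure; rewrite ?inE//.
    by apply: measurableU; [exact: measurableI|exact: mstrip].
  move=> p Ep; have [p1|p1] := leP p.1 1.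
    by left; split => //=; rewrite in_itv.
  by right; rewrite /strip/= in_itv/= p1.
apply: le_trans (measureU2 _ _ _) _; [exact: measurableI|exact: mstrip|].
rewrite -[leRHS]adde0 -(Pi_null mI1 I10); apply: leeD => //.
have -> : 1%E = (cext C 1 1)%:E by rewrite cext_ge1r// clampK ?lexx ?ler01.
by apply: Pi_bigS => q /andP[].
Qed.

Lemma copula_measure_of_density : exists P : probability (R * R)%type R,
  forall u v, P (quad u v) = (cext C u v)%:E.
Proof.
have [P PE] := measure_probability P0T; exists P => u v.
by rewrite PE P0_quad.
Qed.

End copula_measure_exists.

(** * Margins and null sets *)

Section copula_measure.
Context {R : realType}.
Implicit Types (C D : copula R) (P : probability (R * R)%type R) (u v : R).

Lemma copula_measure_exists C : exists P, forall u v, P (quad u v) = (cext C u v)%:E.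
Proof.
have [h [h0 hf hm hi hmono]] := copula_density C.
exact: (copula_measure_of_density h0 hf hm hi hmono).
Qed.

Lemma null_setU d (T : measurableType d) (m : {measure set T -> \bar R})
    (A B : set T) : measurable A -> measurable B -> m A = 0 -> m B = 0 ->
  m (A `|` B) = 0.
Proof.
by move=> mA mB A0 B0; rewrite measureU0.
Qed.

(** The complement of the half-open square with both coordinates in []0, 1]], written with quadrants
    so that its mass can be read off the distribution function. *)
Definition uncovered : set (R * R) := quad 0 1 `|` quad 1 0 `|` ~` quad 1 1.

Lemma measurable_uncovered : measurable uncovered.
Proof.
by apply: measurableU; [apply: measurableU|apply: measurableC];
  exact: measurable_quad.
Qed.

Lemma quad_uncovered C P : (forall u v, P (quad u v) = (cext C u v)%:E) ->
  P uncovered = 0.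
Proof.
move=> PC; have mq := @measurable_quad R.
have muU : measurable (quad 0 1 `|` quad 1 0 : set (R * R)) by exact: measurableU.
have C0 : P (~` quad 1 1) = 0.
  by rewrite probability_setC// PC cext_ge1r// clampK ?lexx ?ler01// subee.
have q01 : P (quad 0 1) = 0 by rewrite PC cext_le0l.
have q10 : P (quad 1 0) = 0 by rewrite PC cext_le0r.
apply: null_setU C0 => //; [exact: measurableC|exact: null_setU].
Qed.

Lemma covered_in (x y : R) : ~ uncovered (x, y) -> 0 < x <= 1 /\ 0 < y <= 1.
Proof.
rewrite /uncovered /quad/= !in_itv/= => /not_orP[/not_orP[n1 n2]].
by move=> /contrapT[x1 y1]; move: n1 n2; rewrite x1 y1 => n1 n2; split;
  rewrite andbT ltNge; apply/negP => ?; [apply: n1|apply: n2].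
Qed.

Lemma measure_modulo_null d (T : measurableType d) (P : {measure set T -> \bar R})
    (A B N : set T) : measurable A -> measurable B -> measurable N -> P N = 0 ->
  (forall p, ~ N p -> A p -> B p) -> (P A <= P B)%E.
Proof.
move=> mA mB mN N0 AB; rewrite -[leRHS]adde0 -N0.
apply: (@le_trans _ _ (P (B `|` N))); last exact: measureU2.
apply: le_measure; rewrite ?inE//; first exact: measurableU.
move=> p Ap; have [Np|nN] := pselect (N p); [by right|by left; exact: AB].
Qed.

Lemma measure_modulo_null_eq d (T : measurableType d) (P : {measure set T -> \bar R})
    (A B N : set T) : measurable A -> measurable B -> measurable N -> P N = 0 ->
  (forall p, ~ N p -> A p <-> B p) -> P A = P B.
Proof.
move=> mA mB mN N0 AB; apply/eqP; rewrite eq_le.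
by rewrite !(@measure_modulo_null _ _ _ _ _ N)// => p /AB[].
Qed.

Lemma quad_copula_measure C P :
  (forall u v, P (quad u v) = (cext C u v)%:E) -> is_copula_measure C P.
Proof.
move=> PC u v u01 v01; rewrite -cextE// -PC.
apply: (measure_modulo_null_eq _ _ measurable_uncovered (quad_uncovered PC)).
- exact: measurableX.
- exact: measurable_quad.
move=> [x y] /covered_in[/andP[x0 _] /andP[y0 _]].
by rewrite /quad/= !in_itv/= (ltW x0) (ltW y0).
Qed.

Lemma measurable_unit_square : measurable (@unit_square R).
Proof. exact: measurableX. Qed.

(** The value at [(1, 1)] puts all the mass on the unit square. Modulo a null set, a quadrant is
    then empty if a coordinate is negative, and otherwise the rectangle with clamped corner. *)
Lemma copula_measure_quad C P :
  is_copula_measure C P -> forall u v, P (quad u v) = (cext C u v)%:E.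
Proof.
move=> PC u v.
have P1 : P unit_square = 1%E.
  rewrite /unit_square PC ?lexx ?ler01// -cextE ?lexx ?ler01//.
  by rewrite cext_ge1r// clampK// lexx ler01.
have PN : P (~` unit_square) = 0.
  rewrite probability_setC ?P1 ?subee//; exact: measurable_unit_square.
have mN : measurable (~` @unit_square R).
  by apply: measurableC; exact: measurable_unit_square.
have [u0|u0] := ltP u 0.
  rewrite cext_le0l ?ltW//; transitivity (P set0); last exact: measure0.
  apply: (measure_modulo_null_eq _ _ mN PN) => //; first exact: measurable_quad.
  move=> [x y] /contrapT[/=]; rewrite /quad/= !in_itv/= => /andP[x0 _] _.
  by split => // -[xu _]; have := le_lt_trans xu u0; rewrite ltNge x0.
have [v0|v0] := ltP v 0.
  rewrite cext_le0r ?ltW//; transitivity (P set0); last exact: measure0.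
  apply: (measure_modulo_null_eq _ _ mN PN) => //; first exact: measurable_quad.
  move=> [x y] /contrapT[/=]; rewrite /quad/= !in_itv/= => _ /andP[y0 _].
  by split => // -[_ yv]; have := le_lt_trans yv v0; rewrite ltNge y0.
rewrite /cext -PC ?clamp01//.
apply: (measure_modulo_null_eq _ _ mN PN).
- exact: measurable_quad.
- exact: measurableX.
move=> [x y] /contrapT[/=]; rewrite /quad/= !in_itv/= => /andP[x0 x1] /andP[y0 y1].
have H (z w : R) : 0 <= z -> z <= 1 -> 0 <= w -> (z <= clamp w) = (z <= w).
  by move=> z0 z1 w0; rewrite /clamp max_r ?le_min ?w0 ?ler01// z1 andbT.
by rewrite x0 y0 !H.
Qed.

Lemma mu_is_copula_measure C : is_copula_measure C (mu C).
Proof.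
have [P PC] := copula_measure_exists C.
by apply: (@xgetPex _ point [set P | is_copula_measure C P]); exists P;
  exact: quad_copula_measure.
Qed.

Lemma mu_quad C u v : mu C (quad u v) = (cext C u v)%:E.
Proof. exact: copula_measure_quad (mu_is_copula_measure C) u v. Qed.

(** Serves to recognise pushforwards and mixtures as measures of copulas from their quadrants
    alone. *)
Lemma mu_unique C (m : {measure set (R * R) -> \bar R}) :
  (forall u v, m (quad u v) = (cext C u v)%:E) ->
  forall A, measurable A -> mu C A = m A.
Proof.
move=> mC; apply: quad_unique => [|u v].
  exact: le_lt_trans (probability_le1 (mu C) measurableT) (ltry 1).
exact: etrans (mu_quad C u v) (esym (mC u v)).
Qed.

Lemma mu_fst C A : measurable A -> mu C (fst @^-1` A) = unif A.
Proof.
move: A; pose m := push (mu C) measurable_fst.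
suff : forall A, measurable A -> m A = unif A by [].
apply: finite_measureR_unique => [|x].
  exact: le_lt_trans (probability_le1 (mu C) measurableT) (ltry 1).
apply: etrans (esym (unif_cdf x)).
rewrite pushE -(cext_ge1r C x (lexx 1)) -mu_quad.
apply: (measure_modulo_null_eq _ _ measurable_uncovered (quad_uncovered (mu_quad C))).
- by rewrite -[X in measurable X]setTI; exact: measurable_fst.
- exact: measurable_quad.
move=> [a b] /covered_in[/andP[x0 _] /andP[y0 y1]].
by rewrite /quad/= !in_itv/= y1; split => // -[].
Qed.

Lemma mu_snd C A : measurable A -> mu C (snd @^-1` A) = unif A.
Proof.
move: A; pose m := push (mu C) measurable_snd.
suff : forall A, measurable A -> m A = unif A by [].
apply: finite_measureR_unique => [|x].
  exact: le_lt_trans (probability_le1 (mu C) measurableT) (ltry 1).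
apply: etrans (esym (unif_cdf x)).
rewrite pushE -(cext_ge1l C x (lexx 1)) -mu_quad.
apply: (measure_modulo_null_eq _ _ measurable_uncovered (quad_uncovered (mu_quad C))).
- by rewrite -[X in measurable X]setTI; exact: measurable_snd.
- exact: measurable_quad.
move=> [a b] /covered_in[/andP[x0 x1] /andP[y0 y1]].
by rewrite /quad/= !in_itv/= x1; split => // -[].
Qed.

Lemma unif_set1 (x : R) : unif [set x] = 0.
Proof. by rewrite unifE /uniform_prob integral_set1. Qed.

Lemma unif_ltE u : unif `]-oo, u[%classic = (clamp u)%:E.
Proof.
rewrite -unif_cdf; apply: (measure_modulo_null_eq _ _ _ (unif_set1 u)) => //.
by move=> x xu; rewrite /= !in_itv/= le_eqVlt; case: eqP.
Qed.

Lemma unif_itvooC : unif (~` `]0, 1[%classic : set R) = 0.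
Proof.
have -> : ~` `]0, 1[ = `]-oo, 0] `|` ~` `]-oo, 1[ :> set R.
  apply/seteqP; split => x /=; rewrite !in_itv/=.
    move=> /negP; rewrite negb_and -leNgt => /orP[]; [by left|].
    by move=> /negP; right.
  move=> [x0|x1]; apply/negP; rewrite negb_and -leNgt ?x0//.
  by move/negP : x1 => ->; rewrite orbT.
have C0 : unif (~` `]-oo, 1[%classic : set R) = 0.
  by rewrite probability_setC// unif_ltE clampK ?lexx ?ler01// subee.
have N0 : unif (`]-oo, 0]%classic : set R) = 0 by rewrite unif_cdf clamp_le0.
by apply: null_setU N0 C0 => //; exact: measurableC.
Qed.

(** A point outside the open square has a coordinate outside []0, 1[], a null event for either
    uniform margin. Hence restricting to the open square loses no mass. *)
Lemma mu_open_square C : mu C (~` open_square) = 0.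
Proof.
have mI : measurable (~` `]0, 1[%classic : set R) by exact: measurableC.
have m1 : measurable (fst @^-1` (~` `]0, 1[%classic) : set (R * R)).
  by rewrite -[X in measurable X]setTI; exact: measurable_fst.
have m2 : measurable (snd @^-1` (~` `]0, 1[%classic) : set (R * R)).
  by rewrite -[X in measurable X]setTI; exact: measurable_snd.
apply/eqP; rewrite -measure_le0.
apply: (@le_trans _ _ (mu C
  (fst @^-1` (~` `]0, 1[%classic) `|` snd @^-1` (~` `]0, 1[%classic)))).
  apply: le_measure; rewrite ?inE.
  - by apply: measurableC; exact: measurable_open_square.
  - exact: measurableU.
  - by move=> [x y] /= /not_andP.
rewrite le_eqVlt null_setU ?eqxx//.
  by apply: etrans (mu_fst C mI) unif_itvooC.
by apply: etrans (mu_snd C mI) unif_itvooC.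
Qed.

Lemma mu_unit_square C : mu C (~` unit_square) = 0.
Proof.
apply/eqP; rewrite -measure_le0 -(mu_open_square C); apply: le_measure; rewrite ?inE.
- by apply: measurableC; exact: measurable_unit_square.
- by apply: measurableC; exact: measurable_open_square.
apply: subsetC => -[x y] [/=]; rewrite /unit_square/= !in_itv/= => /andP[? ?] /andP[? ?].
by rewrite !ltW.
Qed.

End copula_measure.

(** * The form Q *)

Section bounded_integrals.
Context d (T : measurableType d) (R : realType) (P : probability T R).

Lemma bounded_integrable (f : T -> R) (K : R) (D : set T) : measurable D ->
  measurable_fun setT f -> (forall x, `|f x| <= K) ->
  P.-integrable D (EFin \o f).
Proof.
move=> mD mf fK; apply: (@integrableS _ _ _ P setT) => //.
apply: measurable_bounded_integrable => //.
  exact: le_lt_trans (probability_le1 P measurableT) (ltry 1).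
exists K; split; first exact: num_real.
by move=> M KM x _; exact: le_trans (fK x) (ltW KM).
Qed.

Lemma Rintegral_full (f : T -> R) (K : R) (D : set T) : measurable D ->
  P (~` D) = 0 -> measurable_fun setT f -> (forall x, `|f x| <= K) ->
  \int[P]_(x in D) f x = \int[P]_x f x.
Proof.
move=> mD D0 mf fK.
rewrite /Rintegral [in RHS](@negligible_integral _ _ _ P setT (~` D))//.
- by rewrite setTD setCK.
- exact: measurableC.
- exact: bounded_integrable fK.
Qed.

Lemma Rintegral_prob_cst (r : R) : \int[P]_(_ in setT) r = r.
Proof.
rewrite Rintegral_cst//; transitivity (r * fine (P setT)) => //.
by rewrite probability_setT mulr1.
Qed.

End bounded_integrals.

Section Q_theory.
Context {R : realType}.
Implicit Types (C D : copula R).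

Definition cfun C (p : R * R) : R := cext C p.1 p.2.

(** The componentwise order on pairs of points: its sections are lower quadrants in one direction
    and upper quadrants in the other. *)
Definition below : set ((R * R) * (R * R)) :=
  [set z | z.2.1 <= z.1.1 /\ z.2.2 <= z.1.2].

Lemma measurable_below : measurable below.
Proof.
apply: measurableI; rewrite -[X in measurable X]setTI; apply: measurable_fun_le => //.
- exact: measurableT_comp measurable_fst measurable_snd.
- exact: measurableT_comp measurable_fst measurable_fst.
- exact: measurableT_comp measurable_snd measurable_snd.
- exact: measurableT_comp measurable_snd measurable_fst.
Qed.

Lemma mu_xsection C p : mu C (xsection below p) = (cfun C p)%:E.
Proof.
rewrite /cfun -mu_quad; congr (mu C _).
by apply/seteqP; split => -[x y]; rewrite /xsection/quad/below/= !in_itv inE.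
Qed.

(** The value at a point is the mass of a section of the measurable set [below]. *)
Lemma measurable_cfun C : measurable_fun setT (cfun C).
Proof.
have -> : cfun C = fine \o (mu C \o xsection below).
  by apply/funext => p; rewrite /= mu_xsection.
apply: measurableT_comp; first exact: fine_measurable.
exact: measurable_fun_xsection measurable_below.
Qed.

Lemma cfun_norm C p : `|cfun C p| <= 1.
Proof. by rewrite ger0_norm ?cext_ge0// cext_le1. Qed.

Lemma copula_cfun C p : unit_square p -> C p = cfun C p.
Proof.
by case: p => u v [/=]; rewrite !in_itv/= => u01 v01; rewrite /cfun cextE.
Qed.

Lemma QE C D : Q C D = 4 * (\int[mu D]_p cfun C p) - 1.
Proof.
rewrite /Q; congr (4 * _ - 1).
rewrite -(@Rintegral_full _ _ _ (mu D) (cfun C) 1 unit_square)//.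
- by apply: eq_Rintegral => p /set_mem; exact: copula_cfun.
- exact: measurable_unit_square.
- exact: mu_unit_square.
- exact: measurable_cfun.
- exact: cfun_norm.
Qed.

Lemma integrable_cfun C D : (mu D).-integrable setT (EFin \o cfun C).
Proof. by apply: bounded_integrable (@cfun_norm C) => //; exact: measurable_cfun. Qed.

Lemma measurable_clamp : measurable_fun setT (@clamp R).
Proof.
apply: measurable_maxr => //; exact: measurable_minr.
Qed.

Lemma Rintegral_push d1 d2 (T1 : measurableType d1) (T2 : measurableType d2)
  (P : probability T1 R) (P' : probability T2 R) (g : T1 -> T2) (f : T2 -> R) (K : R) :
  measurable_fun setT g ->
  measurable_fun setT f -> (forall x, `|f x| <= K) ->
  (forall A, measurable A -> P' A = P (g @^-1` A)) ->
  \int[P']_x f x = \int[P]_x f (g x).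
Proof.
move=> mg mf fK PE; rewrite /Rintegral; congr fine.
transitivity (\int[push P mg]_x (f x)%:E)%E.
  by apply: eq_measure_integral => A mA _; exact: PE.
rewrite integral_pushforward ?preimage_setT//.
  exact/measurable_EFinP.
apply: (bounded_integrable _ _ (K := K)) => //=.
exact: (measurableT_comp mf mg).
Qed.

Lemma unif_clampX (n : nat) : \int[unif]_x (clamp x) ^+ n = n.+1%:R^-1 :> R.
Proof.
have mf : measurable_fun setT (fun x => (clamp x ^+ n)%:E : \bar R).
  by apply/measurable_EFinP; apply: measurable_funX; exact: measurable_clamp.
rewrite (@Rintegral_push _ _ _ _ (uniform_prob (@ltr01 R)) unif _ _ 1
  (@measurable_toR R)); last 3 first.
- exact/measurable_EFinP.
- move=> x; rewrite ger0_norm ?exprn_ge0 ?clamp_ge0//.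
  by rewrite exprn_ile1 ?clamp_ge0 ?clamp_le1.
- by move=> A mA; rewrite unifE.
rewrite /Rintegral.
rewrite integral_uniform//; last first.
  by move=> x; rewrite lee_fin exprn_ge0// clamp_ge0.
rewrite subr0 invr1 mul1e.
(* The moment is the beta integral with parameters [n.+1] and [1]. *)
transitivity (\int[@lebesgue_measure R]_(x in `[0%R, 1%R]) XMonemX n 0 x).
  apply: eq_Rintegral => x /set_mem/=; rewrite in_itv/= => x01.
  by rewrite XMonemXn0 clampK.
rewrite Rintegral_mkcond -[LHS]/(beta_fun n.+1 1).
by rewrite beta_fun_sym beta_fun1Sn.
Qed.

Lemma unif_clamp : \int[unif]_x clamp x = 2^-1 :> R.
Proof.
by rewrite -(unif_clampX 1); apply: eq_Rintegral => x _; rewrite expr1.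
Qed.

Lemma mu_int_fst C : \int[mu C]_p clamp p.1 = 2^-1 :> R.
Proof.
rewrite -unif_clamp; apply/esym.
apply: (@Rintegral_push _ _ _ _ (mu C) unif fst (@clamp R) 1).
- exact: measurable_fst.
- exact: measurable_clamp.
- by move=> x; rewrite ger0_norm ?clamp_ge0 ?clamp_le1.
- by move=> A mA; rewrite mu_fst.
Qed.

Lemma mu_int_snd C : \int[mu C]_p clamp p.2 = 2^-1 :> R.
Proof.
rewrite -unif_clamp; apply/esym.
apply: (@Rintegral_push _ _ _ _ (mu C) unif snd (@clamp R) 1).
- exact: measurable_snd.
- exact: measurable_clamp.
- by move=> x; rewrite ger0_norm ?clamp_ge0 ?clamp_le1.
- by move=> A mA; rewrite mu_snd.
Qed.

End Q_theory.

(** * Symmetry, monotonicity, Lipschitz continuity and biaffinity of [Q] *)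

Section Q_symmetry.
Context {R : realType}.
Implicit Types (C D : copula R).

(** This is the survival function, by inclusion-exclusion on two open half-planes. Open and closed
    quadrants have the same mass because the margins have no atoms. *)
Lemma mu_ysection C (p : R * R) :
  mu C (ysection below p) = (1 - clamp p.1 - clamp p.2 + cfun C p)%:E.
Proof.
case: p => a b /=.
pose X : set (R * R) := fst @^-1` `]-oo, a[%classic.
pose Y : set (R * R) := snd @^-1` `]-oo, b[%classic.
have mX : measurable X.
  by rewrite -[X in measurable X]setTI; exact: measurable_fst.
have mY : measurable Y.
  by rewrite -[X in measurable X]setTI; exact: measurable_snd.
have -> : ysection below (a, b) = ~` (X `|` Y).
  rewrite /X /Y; apply/seteqP; split => -[x y]; rewrite /ysection/below/= inE/= !in_itv/=.
    by move=> [ax bx] []; rewrite ltNge ?ax ?bx.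
  by move=> /not_orP[/negP + /negP]; rewrite -!leNgt.
rewrite probability_setC; last exact: measurableU.
have XE : mu C X = (clamp a)%:E by rewrite mu_fst ?unif_ltE//; exact: measurable_itv.
have YE : mu C Y = (clamp b)%:E by rewrite mu_snd ?unif_ltE//; exact: measurable_itv.
have XYE : mu C (X `&` Y) = (cfun C (a, b))%:E.
  rewrite -mu_quad /=.
  pose N : set (R * R) := fst @^-1` [set a] `|` snd @^-1` [set b].
  have ma : measurable (fst @^-1` [set a] : set (R * R)).
    by rewrite -[X in measurable X]setTI; exact: measurable_fst.
  have mb : measurable (snd @^-1` [set b] : set (R * R)).
    by rewrite -[X in measurable X]setTI; exact: measurable_snd.
  apply: (@measure_modulo_null_eq _ _ _ (mu C) _ _ N).
  - exact: measurableI.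
  - exact: measurable_quad.
  - exact: measurableU.
  - apply: null_setU => //.
      by apply: etrans (mu_fst C _) (unif_set1 a).
    by apply: etrans (mu_snd C _) (unif_set1 b).
  - move=> [x y] /= /not_orP[/eqP xa /eqP yb].
    by rewrite /X /Y /quad/= !in_itv/= !lt_neqAle xa yb.
have fX : (mu C X < +oo)%E by rewrite XE ltry.
have UE : mu C (X `|` Y) = (mu C X + mu C Y - mu C (X `&` Y))%E :=
  measureUfinl mX mY fX.
rewrite UE XE YE XYE.
by rewrite -!EFinD; congr EFin; ring.
Qed.

(** Fubini on [below] replaces the distribution function of [C] by the survival function of [D]; the
    affine terms integrate to [1 - 1/2 - 1/2 = 0]. *)
Lemma cfun_int_sym C D :
  \int[mu D]_p cfun C p = \int[mu C]_p cfun D p.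
Proof.
transitivity (\int[mu C]_p (1 - clamp p.1 - clamp p.2 + cfun D p)).
  rewrite /Rintegral; congr fine.
  transitivity (\int[mu D]_p (mu C (xsection below p)))%E.
    by apply: eq_integral => p _; rewrite mu_xsection.
  transitivity (\int[mu C]_p (mu D (ysection below p)))%E; last first.
    by apply: eq_integral => p _; rewrite mu_ysection.
  have := indic_fubini_tonelli (mu D) (mu C) (@measurable_below R).
  by rewrite indic_fubini_tonelli_FE ?indic_fubini_tonelli_GE//; exact: measurable_below.
have m1 : measurable_fun setT (fun p : R * R => clamp p.1) :=
  measurableT_comp measurable_clamp measurable_fst.
have m2 : measurable_fun setT (fun p : R * R => clamp p.2) :=
  measurableT_comp measurable_clamp measurable_snd.
have b1 (p : R * R) : `|clamp p.1| <= 1 by rewrite ger0_norm ?clamp_ge0 ?clamp_le1.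
have b2 (p : R * R) : `|clamp p.2| <= 1 by rewrite ger0_norm ?clamp_ge0 ?clamp_le1.
have i1 : (mu C).-integrable setT (EFin \o (fun p : R * R => clamp p.1)).
  exact: bounded_integrable b1.
have i2 : (mu C).-integrable setT (EFin \o (fun p : R * R => clamp p.2)).
  exact: bounded_integrable b2.
have i0 : (mu C).-integrable setT (EFin \o (fun p : R * R => 1 : R)).
  by apply: (@bounded_integrable _ _ _ _ _ 1) => // x; rewrite normr1.
have i01 : (mu C).-integrable setT (EFin \o (fun p : R * R => 1 - clamp p.1)).
  apply: (@bounded_integrable _ _ _ _ _ 1) => //; first exact: measurable_funB.
  move=> p; rewrite ler_norml; have := clamp_ge0 p.1; have := clamp_le1 p.1.
  by move=> ? ?; apply/andP; split; lra.
have i012 : (mu C).-integrable setT 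
    (EFin \o (fun p : R * R => 1 - clamp p.1 - clamp p.2)).
  apply: (@bounded_integrable _ _ _ _ _ 1) => //.
    by apply: measurable_funB => //; exact: measurable_funB.
  move=> p; rewrite ler_norml; have := clamp_ge0 p.1; have := clamp_le1 p.1.
  have := clamp_ge0 p.2; have := clamp_le1 p.2.
  by move=> ? ? ? ?; apply/andP; split; lra.
rewrite RintegralD//; last exact: integrable_cfun.
rewrite RintegralB// RintegralB// mu_int_fst mu_int_snd Rintegral_prob_cst.
by lra.
Qed.

Lemma Q_sym C D : Q C D = Q D C.
Proof. by rewrite !QE cfun_int_sym. Qed.

Lemma le_Q C D : forall E, cop_le C D -> Q C E <= Q D E.
Proof.
move=> E CD; rewrite !QE lerD2r ler_pM2l//.
apply: le_Rintegral => //; [exact: integrable_cfun..|].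
by move=> p _; apply: CD; split; rewrite /= in_itv/=; exact: clamp01.
Qed.

Lemma Q_dist C D E e : (forall p, unit_square p -> `|C p - D p| <= e) ->
  `|Q C E - Q D E| <= 4 * e.
Proof.
move=> CDe; have CE p : `|cfun C p - cfun D p| <= e.
  by apply: CDe; split; rewrite /= in_itv/=; exact: clamp01.
rewrite !QE (_ : _ - _ =
  4 * (\int[mu E]_p cfun C p - \int[mu E]_p cfun D p)); last by lra.
rewrite normrM ger0_norm// ler_pM2l//.
rewrite -RintegralB//; [|exact: integrable_cfun..].
have mB : measurable_fun setT (fun p => cfun C p - cfun D p).
  by apply: measurable_funB; exact: measurable_cfun.
apply: le_trans (le_normr_Rintegral _ _) _ => //.
  exact: bounded_integrable CE.
apply: le_trans (le_Rintegral (f2 := cst e) _ _ _ _) _ => //.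
- apply: (@bounded_integrable _ _ _ _ _ e) => //; first exact: measurableT_comp.
  by move=> x; rewrite normr_id.
- by apply: (@bounded_integrable _ _ _ _ _ `|e|).
- by rewrite Rintegral_prob_cst.
Qed.

Lemma Q_mixl t C D E : Q (mix t C D) E = (1 - t%:num) * Q C E + t%:num * Q D E.
Proof.
rewrite !QE.
have -> : \int[mu E]_p cfun (mix t C D) p =
    \int[mu E]_p ((1 - t%:num) * cfun C p + t%:num * cfun D p) by [].
have iC : (mu E).-integrable setT (EFin \o (fun p => (1 - t%:num) * cfun C p)).
  exact: (integrableZl measurableT _ (integrable_cfun C E)).
have iD : (mu E).-integrable setT (EFin \o (fun p => t%:num * cfun D p)).
  exact: (integrableZl measurableT _ (integrable_cfun D E)).
rewrite RintegralD// !RintegralZl//; [|exact: integrable_cfun..].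
by lra.
Qed.

Lemma Q_mixr t C D E : Q E (mix t C D) = (1 - t%:num) * Q E C + t%:num * Q E D.
Proof. by rewrite Q_sym Q_mixl (Q_sym C) (Q_sym D). Qed.

Lemma mu_mix t C D A : measurable A ->
  mu (mix t C D) A = ((1 - t%:num)%:E * mu C A + (t%:num)%:E * mu D A)%E.
Proof.
have t0 : 0 <= t%:num by [].
have s0 : 0 <= 1 - t%:num by rewrite subr_ge0.
pose m := measure_add (mscale (NngNum s0) (mu C)) (mscale (NngNum t0) (mu D)).
have mE B : m B = ((1 - t%:num)%:E * mu C B + (t%:num)%:E * mu D B)%E.
  by rewrite /m measure_addE.
move=> mA; rewrite -mE; apply: mu_unique mA => u v.
by apply: etrans (mE _) _; rewrite !mu_quad.
Qed.

End Q_symmetry.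

(** * Symmetries *)

Section symmetries.
Context {R : realType}.
Implicit Types (C D : copula R).

Lemma CopulaE (f : R * R -> R) (fP : is_copula f) p : Copula fP p = f p.
Proof. by []. Qed.

Lemma measurable_sym_pi : measurable_fun setT (@sym_pi R).
Proof.
by apply/measurable_fun_pairP; split; [exact: measurable_snd|exact: measurable_fst].
Qed.

Lemma measurable_sym_sigma1 : measurable_fun setT (@sym_sigma1 R).
Proof.
apply/measurable_fun_pairP; split; last exact: measurable_snd.
by apply: measurable_funB => //; exact: measurable_fst.
Qed.

Lemma clamp1B (x : R) : clamp (1 - x) = 1 - clamp x.
Proof. by case: (clampP x) => ?; case: (clampP (1 - x)) => ?; lra. Qed.

Lemma mu_pi_quad C u v : mu C (@sym_pi R @^-1` quad u v) = (cext C v u)%:E.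
Proof.
by rewrite -mu_quad; congr (mu C _); rewrite predeqE => -[x y]; rewrite /quad/=; tauto.
Qed.

(** Up to a vertical line, which is null, the reflected quadrant is the half-plane below height [v]
    minus the quadrant at [(1 - u, v)]. *)
Lemma mu_sigma1_quad C u v :
  mu C (@sym_sigma1 R @^-1` quad u v) = (clamp v - cext C (1 - u) v)%:E.
Proof.
pose B : set (R * R) := snd @^-1` `]-oo, v].
have mB : measurable B.
  by rewrite -[X in measurable X]setTI; exact: measurable_snd.
have BE : mu C B = (clamp v)%:E.
  by apply: etrans (mu_snd C (measurable_itv `]-oo, v])) (unif_cdf v).
have mq := @measurable_quad R (1 - u) v.
have fB : (mu C B < +oo)%E by rewrite BE ltry.
have DE : mu C (B `\` quad (1 - u) v) = (mu C B - mu C (B `&` quad (1 - u) v))%E :=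
  measureD mB mq fB.
have IE : B `&` quad (1 - u) v = quad (1 - u) v.
  by rewrite setIidr// => -[x y] [].
rewrite EFinB -mu_quad -BE -[X in (_ - mu C X)%E]IE -DE.
have ma : measurable (fst @^-1` [set 1 - u] : set (R * R)).
  by rewrite -[X in measurable X]setTI; exact: measurable_fst.
apply: (@measure_modulo_null_eq _ _ _ (mu C) _ _ (fst @^-1` [set 1 - u])) => //.
- rewrite -[X in measurable X]setTI; apply: measurable_sym_sigma1 => //.
  exact: measurable_quad.
- exact: measurableD.
- by apply: etrans (mu_fst C _) (unif_set1 _).
move=> [x y] /= /eqP xu; rewrite /B /quad /sym_sigma1/= !in_itv/=.
have -> : (1 - x <= u) = ~~ (x <= 1 - u).
  by rewrite -ltNge lt_neqAle eq_sym xu/=; apply/idP/idP; lra.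
split=> [[/negP nx yv]|[yv nx]]; first by split => // -[].
by split => //; apply/negP => xu'; apply: nx.
Qed.

Lemma copula_pi_subproof C : is_copula (on_square (C \o @sym_pi R)).
Proof.
have [_ Cl Cr C1 C2 Ci] := copula_funP C.
apply: on_square_copula; rewrite /sym_pi/=.
- exact: Cr.
- exact: Cl.
- exact: C2.
- exact: C1.
- move=> u1 u2 v1 v2 u10 u12 u21 v10 v12 v21.
  by have := Ci _ _ _ _ v10 v12 v21 u10 u12 u21; lra.
Qed.

Lemma copula_sigma1_subproof C :
  is_copula (on_square (fun p => p.2 - C (1 - p.1, p.2))).
Proof.
have [_ Cl Cr C1 C2 Ci] := copula_funP C.
have H (u : R) : 0 <= u <= 1 -> 0 <= 1 - u <= 1.
  by move=> /andP[? ?]; apply/andP; split; lra.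
apply: on_square_copula => /=.
- by move=> v v01; rewrite subr0 C2// subrr.
- by move=> u /H u01; rewrite Cr// subrr.
- by move=> u /H u01; rewrite C1//; lra.
- by move=> v v01; rewrite subrr Cl// subr0.
- move=> u1 u2 v1 v2 u10 u12 u21 v10 v12 v21.
  have := Ci (1 - u2) (1 - u1) v1 v2.
  by move=> /(_ ltac:(lra) ltac:(lra) ltac:(lra) v10 v12 v21); lra.
Qed.

(** Induction on words in the generators. The last clause guarantees that the choice made in [act]
    finds a copula with the pushed-forward measure; the middle one lets restriction to the open
    square commute with the symmetries. *)
Lemma D4P (g : R * R -> R * R) : D4 g -> [/\ measurable_fun setT g,
  forall p, open_square (g p) <-> open_square p &
  forall C, exists D, forall A, measurable A -> mu D A = mu C (g @^-1` A)].
Proof.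
elim=> [|||h1 h2 _ [m1 o1 E1] _ [m2 o2 E2]].
- by split => // C; exists C.
- split; first exact: measurable_sym_pi.
    by move=> [x y]; rewrite /open_square/=; tauto.
  move=> C; exists (Copula (copula_pi_subproof C)) => A mA.
  rewrite -(pushE _ measurable_sym_pi); apply: mu_unique mA => u v.
  apply: etrans (mu_pi_quad C u v) _.
  by rewrite /cext [in RHS]CopulaE on_squareE ?clamp01.
- split; first exact: measurable_sym_sigma1.
    move=> [x y]; rewrite /open_square/= !in_itv/=.
    have -> : (0 < 1 - x < 1) = (0 < x < 1); last by [].
    by apply/idP/idP => /andP[? ?]; apply/andP; split; lra.
  move=> C; exists (Copula (copula_sigma1_subproof C)) => A mA.
  rewrite -(pushE _ measurable_sym_sigma1); apply: mu_unique mA => u v.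
  apply: etrans (mu_sigma1_quad C u v) _.
  by rewrite /cext [in RHS]CopulaE on_squareE ?clamp01//= clamp1B.
- split; first exact: measurableT_comp.
    by move=> p; rewrite /= o1 o2.
  move=> C; have [D DE] := E2 C; have [D' D'E] := E1 D.
  exists D' => A mA; rewrite D'E// DE//.
  by rewrite -[X in measurable X]setTI; exact: m1.
Qed.

Lemma mu_act C g A : D4 g -> measurable A -> mu (act C g) A = mu C (g @^-1` A).
Proof.
move=> /D4P[_ _ /(_ C)[D DE]] mA.
have : [set D | forall A, measurable A -> mu D A = pushforward (mu C) g A] (act C g).
  by apply: (@xgetPex _ C); exists D => B mB; rewrite DE.
by move=> /(_ A mA).
Qed.

Lemma cext_pi C u v : cext (act C (@sym_pi R)) u v = cext C v u.
Proof.
apply: EFin_inj; rewrite -mu_quad mu_act ?mu_pi_quad//; first exact: D4_pi.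
exact: measurable_quad.
Qed.

Lemma cext_sigma1 C u v :
  cext (act C (@sym_sigma1 R)) u v = clamp v - cext C (1 - u) v.
Proof.
apply: EFin_inj; rewrite -mu_quad mu_act ?mu_sigma1_quad//; first exact: D4_sigma1.
exact: measurable_quad.
Qed.

Lemma cext_ext C D : (forall u v, cext C u v = cext D u v) -> C = D.
Proof. by move=> CD; apply: copula_ext => u v u01 v01; rewrite -!cextE. Qed.

Lemma act_sigma1K C : act (act C (@sym_sigma1 R)) (@sym_sigma1 R) = C.
Proof.
apply: cext_ext => u v; rewrite !cext_sigma1.
by rewrite (_ : 1 - (1 - u) = u); lra.
Qed.

Lemma cext_copPi (u v : R) : cext copPi u v = clamp u * clamp v.
Proof. by rewrite /cext CopulaE on_squareE ?clamp01. Qed.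

Lemma cext_copM (u v : R) : cext copM u v = Num.min (clamp u) (clamp v).
Proof. by rewrite /cext CopulaE on_squareE ?clamp01. Qed.

Lemma act_sigma1_copPi : act copPi (@sym_sigma1 R) = copPi.
Proof.
by apply: cext_ext => u v; rewrite cext_sigma1 !cext_copPi clamp1B; lra.
Qed.

Lemma Q_pi C D : Q (act C (@sym_pi R)) (act D (@sym_pi R)) = Q C D.
Proof.
rewrite !QE; congr (4 * _ - 1).
rewrite (@Rintegral_push _ _ _ _ _ (mu D) _ _ _ 1 measurable_sym_pi).
- by apply: eq_Rintegral => -[u v] _; rewrite /cfun cext_pi.
- exact: measurable_cfun.
- exact: cfun_norm.
- by move=> A mA; rewrite mu_act//; exact: D4_pi.
Qed.

(** With [I] the integral of the reflected [C] coordinatewise against [mu D], the left side is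
    [4 * (1/2 - I) - 1], where 1/2 is the mean of the second margin, and the right side is
    [- (4 * I - 1)]. *)
Lemma Q_sigma1 C D : Q (act C (@sym_sigma1 R)) D = - Q C (act D (@sym_sigma1 R)).
Proof.
rewrite !QE.
rewrite [in RHS](@Rintegral_push _ _ _ _ _ (mu D) _ _ _ 1
  measurable_sym_sigma1); last 3 first.
- exact: measurable_cfun.
- exact: cfun_norm.
- by move=> A mA; rewrite mu_act//; exact: D4_sigma1.
have -> : \int[mu D]_p cfun (act C (@sym_sigma1 R)) p =
  \int[mu D]_p (clamp p.2 - cfun C (sym_sigma1 p)).
  by apply: eq_Rintegral => -[u v] _; rewrite /cfun cext_sigma1.
rewrite RintegralB// ?mu_int_snd; first by lra.
- apply: (@bounded_integrable _ _ _ _ _ 1) => //.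
    exact: (measurableT_comp measurable_clamp measurable_snd).
  by move=> p; rewrite ger0_norm ?clamp_ge0 ?clamp_le1.
- apply: (@bounded_integrable _ _ _ _ _ 1) => //.
    exact: (measurableT_comp (measurable_cfun C) measurable_sym_sigma1).
  by move=> p; exact: cfun_norm.
Qed.

Lemma Q_Pi_Pi : Q (@copPi R) copPi = 0.
Proof.
by have := Q_sigma1 copPi copPi; rewrite act_sigma1_copPi; lra.
Qed.

Definition diag (x : R) : R * R := (x, x).

Lemma measurable_diag : measurable_fun setT diag.
Proof. by apply/measurable_fun_pairP; split; exact: measurable_id. Qed.

Lemma mu_copM A : measurable A -> mu copM A = unif (diag @^-1` A).
Proof.
move=> mA; rewrite -(pushE _ measurable_diag); apply: mu_unique mA => u v.
rewrite pushE cext_copM.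
have -> : Num.min (clamp u) (clamp v) = clamp (Num.min u v).
  have [uv|vu] := leP u v; first by rewrite min_l// le_clamp.
  by rewrite min_r// le_clamp// ltW.
apply: etrans (unif_cdf _); congr (unif _).
by apply/seteqP; split => x; rewrite /quad/= !in_itv/= le_min => /andP.
Qed.

Lemma Q_copM C : Q C copM = 4 * (\int[unif]_x cext C x x) - 1.
Proof.
rewrite QE (@Rintegral_push _ _ _ _ _ unif _ _ _ 1 measurable_diag)//.
- exact: measurable_cfun.
- exact: cfun_norm.
- exact: mu_copM.
Qed.

Lemma Q_M_M : Q (@copM R) copM = 1.
Proof.
rewrite Q_copM; under eq_Rintegral do rewrite cext_copM minxx.
by rewrite unif_clamp; lra.
Qed.

Lemma Q_Pi_M : Q (@copPi R) copM = 3^-1.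
Proof.
rewrite Q_copM; under eq_Rintegral do rewrite cext_copPi -expr2.
by rewrite unif_clampX; lra.
Qed.

End symmetries.

(** * The field of a map of copulas *)

Section field_of_Theta.
Context {R : realType}.
Variable Theta : copula R -> copula R.
Implicit Types (C D : copula R).

Lemma nu_ofE C A :
  nu_of Theta C A = (4%:E * mu (Theta C) (A `&` open_square))%E.
Proof. by []. Qed.

Lemma nu_of_open C : (nu_of Theta C open_square < +oo)%E.
Proof.
rewrite nu_ofE setIid; apply: lte_mul_pinfty => //.
apply: le_lt_trans (ltry 1).
exact: probability_le1 (@measurable_open_square R).
Qed.

Lemma nu_of_integrable C (f : R * R -> R) : measurable_fun setT f ->
  (forall p, `|f p| <= 1) ->
  (nu_of Theta C).-integrable open_square (EFin \o f).
Proof.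
move=> mf f1; apply: measurable_bounded_integrable.
- exact: measurable_open_square.
- exact: nu_of_open.
- exact: measurable_funTS.
- exists 1; split; first exact: num_real.
  by move=> M M1 p _; exact: le_trans (f1 p) (ltW M1).
Qed.

Lemma nu_of_integral C (f : R * R -> R) : measurable_fun setT f ->
  (forall p, 0 <= f p <= 1) ->
  \int[nu_of Theta C]_(p in open_square) f p = 4 * (\int[mu (Theta C)]_p f p).
Proof.
move=> mf f01.
have fn p : `|f p| <= 1 by case/andP: (f01 p) => ? ?; rewrite ger0_norm.
have mo := @measurable_open_square R.
rewrite -(Rintegral_full mo (mu_open_square (Theta C)) mf fn).
have mfE : measurable_fun open_square (EFin \o f).
  by apply/measurable_EFinP; exact: measurable_funTS.
rewrite /Rintegral.
have -> : (\int[nu_of Theta C]_(p in open_square) (f p)%:E =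
  \int[mscale (4%:R%:nng : {nonneg R})%R (mu (Theta C))]_(p in open_square) (f p)%:E)%E.
  apply: eq_measure_integral => A mA Ao.
  by rewrite nu_ofE setIidl.
rewrite ge0_integral_mscale//; last first.
  by move=> p _; rewrite lee_fin; case/andP: (f01 p).
rewrite fineM//.
apply: integrable_fin_num => //.
exact: bounded_integrable fn.
Qed.

Lemma int_dev_nu C D :
  int_dev C (nu_of Theta D) = Q C (Theta D) - Q copPi (Theta D).
Proof.
rewrite /int_dev.
have os (p : R * R) : open_square p -> unit_square p.
  case: p => x y [/=]; rewrite /unit_square/= !in_itv/= => /andP[? ?] /andP[? ?].
  by rewrite !ltW.
have -> : \int[nu_of Theta D]_(p in open_square) (C p - copPi p) =
    \int[nu_of Theta D]_(p in open_square) (cfun C p - cfun copPi p).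
  by apply: eq_Rintegral => p /set_mem /os u; rewrite !copula_cfun.
have i E : (nu_of Theta D).-integrable open_square (EFin \o cfun E).
  by apply: nu_of_integrable; [exact: measurable_cfun|exact: cfun_norm].
have b E (p : R * R) : 0 <= cfun E p <= 1 by rewrite cext_ge0 cext_le1.
rewrite RintegralB//; last exact: measurable_open_square.
by rewrite !nu_of_integral//; [rewrite !QE; lra|exact: measurable_cfun..].
Qed.

(** The measure is finite and the weight [w] is bounded. *)
Lemma nu_of_Mw C : Mw_plus (nu_of Theta C).
Proof.
split.
  by rewrite nu_ofE setICl measure0 mule0.
have -> : (\int[nu_of Theta C]_(p in open_square) (w p)%:E =
    \int[nu_of Theta C]_(p in open_square) (cfun copM p - cfun copW p)%:E)%E.
  apply: eq_integral => -[x y] /set_mem [/=]; rewrite !in_itv/= => /andP[? ?] /andP[? ?].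
  by rewrite /w !copula_cfun// /unit_square; split; rewrite /= in_itv/= !ltW.
apply: integrable_lty; first exact: measurable_open_square.
apply: nu_of_integrable.
  by apply: measurable_funB; exact: measurable_cfun.
move=> p; have := cext_ge0 copM p.1 p.2; have := cext_ge0 copW p.1 p.2.
have := cext_le1 copM p.1 p.2; have := cext_le1 copW p.1 p.2.
by rewrite /cfun ler_norml => ? ? ? ?; apply/andP; split; lra.
Qed.

End field_of_Theta.

(** * Uniform closeness of copulas, and the proof of the theorem *)

Section uniform_topology.
Context {R : realType}.

Lemma copula_near (C : copula R) (e : R) : 0 < e ->
  \forall D \near C, forall p, unit_square p -> `|C p - (D : copula R) p| <= e.
Proof.
move=> e0.
have : nbhs (set_val C : {uniform` (@unit_square R) -> R})
    [set h | forall p, unit_square p -> `|C p - h p| <= e].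
  apply/uniform_nbhs; exists [set xy : R * R | ball xy.1 e xy.2]; split.
    exact: (@entourage_ball R R (PosNum e0)).
  by move=> h Ch p up; have := Ch p up; rewrite /ball/= => /ltW.
exact: (@initial_continuous _ _
  (set_val : copula R -> {uniform` (@unit_square R) -> R}) C).
Qed.

End uniform_topology.

Theorem proposition4p1 (R : realType) (Theta : copula R -> copula R)
  (Theta_cont : continuous Theta)
  (Theta_affine : affine_copula_map Theta)
  (S1 : forall (C : copula R) (g : R * R -> R * R), D4 g ->
    Theta (act C g) = act (Theta C) g)
  (S2 : Theta copPi = copPi /\ Theta copM = copM)
  (S3 : forall C D : copula R, Q (Theta C) D = Q C (Theta D)) :
  let kappa := kappa_of (nu_of Theta) in
  [/\ admissible (nu_of Theta),
      forall C : copula R, kappa C = Q (Theta C) C,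
      forall C D : copula R, polarization kappa C D = Q (Theta C) D,
      measure_of_concordance kappa
    & exact_degree2 kappa].
Proof.
move=> kappa; case: S2 => TPi TM.
have devE C D : int_dev C (nu_of Theta D) = Q C (Theta D) - Q copPi D.
  by rewrite int_dev_nu -[Q copPi (Theta D)]S3 TPi.
have kappaE C : kappa C = Q (Theta C) C.
  rewrite /kappa /kappa_of !devE TPi Q_Pi_Pi subr0 S3 (Q_sym C copPi); lra.
(* Self-adjointness of [Theta] for the symmetric form [Q] makes the twisted form symmetric, so that
   the two cross terms of [kmix] merge. *)
have sw C D : Q (Theta C) D = Q (Theta D) C by rewrite S3 Q_sym.
have kmix t C D : kappa (mix t C D) = (1 - t%:num) ^+ 2 * kappa C +
    2 * ((1 - t%:num) * t%:num) * Q (Theta C) D + t%:num ^+ 2 * kappa D.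
  rewrite !kappaE Theta_affine Q_mixl !Q_mixr (sw D C); ring.
have kcont : continuous kappa.
  move=> C; have F : Filter (nbhs C) := nbhs_filter C.
  apply/(@cvgrPdist_le _ _ _ (nbhs C) F) => e e0.
  (* Two successive replacements, of [Theta C] and then of [C], each cost at most [4 * (e / 8)]. *)
  have e8 : 0 < e / 8 by rewrite divr_gt0.
  have nC := copula_near C e8.
  have nT := Theta_cont C _ (copula_near (Theta C) e8).
  apply: (@filterS _ (nbhs C) F _ _ _ (@filterI _ (nbhs C) F _ _ nC nT)).
  move=> D [CD TCD].
  have := Q_dist C TCD; have := Q_dist (Theta D) CD.
  rewrite !kappaE (Q_sym C) (Q_sym D) !ler_norml => /andP[? ?] /andP[? ?].
  by apply/andP; split; lra.
have kM : kappa copM = 1 by rewrite kappaE TM Q_M_M.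
have pol C D : polarization kappa C D = Q (Theta C) D.
  by rewrite /polarization kmix/=; lra.
split.
- split.
  + exact: nu_of_Mw.
  + move=> t C D A mA; rewrite !nu_ofE Theta_affine.
    rewrite mu_mix; last by apply: measurableI => //; exact: measurable_open_square.
    rewrite ge0_muleDr ?mule_ge0 ?lee_fin ?subr_ge0//.
    by congr (_ + _)%E; exact: muleCA.
  (* The left side amounts to [Q D (Theta C) - Q copPi C - Q D copPi], which is symmetric in [C] and
     [D]. *)
  + move=> C D; rewrite !devE TPi Q_Pi_Pi -[Q D (Theta C)]S3 (sw D C).
    by rewrite -[Q C (Theta D)]S3 (Q_sym D copPi) (Q_sym C copPi); lra.
  + move=> C g A Dg mA; have [mg og _] := D4P Dg.
    rewrite nu_ofE S1// mu_act//; last first.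
      by apply: measurableI => //; exact: measurable_open_square.
    rewrite /pushforward nu_ofE preimage_setI; congr (_ * mu _ (_ `&` _))%E.
    by apply/seteqP; split => p /og.
  + exact: kcont.
  + exact: kM.
- exact: kappaE.
- exact: pol.
- split.
  + by move=> C; rewrite !kappaE S1 ?Q_pi//; exact: D4_pi.
  (* [Theta] need not preserve the order. For the first inequality (S3) moves it onto the other
     argument, so that only [C] is replaced by [D]; the second is monotonicity of [Q] in its plain
     argument. *)
  + move=> C D CD; rewrite !kappaE; apply: (@le_trans _ _ (Q (Theta D) C)).
      by rewrite (S3 C C) (S3 D C); exact: le_Q.
    by rewrite Q_sym (Q_sym _ D); exact: le_Q.
  + exact: kM.
  + move=> C; rewrite !kappaE S1; last exact: D4_sigma1.
    by rewrite Q_sigma1 act_sigma1K.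
  + by move=> C_ C CC; apply: cvg_comp CC _; exact: kcont.
- split.
    move=> C D.
    (* The coefficients of [kmix] expanded in powers of [t]. *)
    exists (Poly [:: kappa C; 2 * (Q (Theta C) D - kappa C);
                     kappa C - 2 * Q (Theta C) D + kappa D]).
      exact: size_Poly.
    by move=> t; rewrite kmix horner_Poly/=; ring.
  move=> aff; have := pol copPi copM; rewrite /polarization aff TPi Q_Pi_M.
  have kPi : kappa copPi = 0 by rewrite kappaE TPi Q_Pi_Pi.
  by rewrite kPi kM/=; lra.
Qed.
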